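(* Let $A$ be an infinite dimensional simple separable unital C*-algebra. Then the set of tracially approximately inner automorphisms of $A$ is a group (under composition).
   Context: Tracial approximate innerness: for an infinite dimensional simple separable unital C*-algebra $A$, $\alpha \in \mathrm{Aut}(A)$ is tracially approximately inner if for every finite set $F \subset A$, every $\varepsilon > 0$, and every positive element $x \in A$ with $\|x\| = 1$, there exist $p_1, p_2, v \in A$ such that: (1) $p_1$ and $p_2$ are projections, $v^*v = p_1$, and $vv^* = \alpha(p_2)$; (2) $\|p_1 a - a p_1\| < \varepsilon$ and $\|p_2 a - a p_2\| < \varepsilon$ for all $a \in F$; (3) $\|v p_1 a p_1 v^* - \alpha(p_2 a p_2)\| < \varepsilon$ for all $a \in F$; (4) $1 - p_1$ and $1 - p_2$ are Murray-von Neumann equivalent to projections (possibly zero) in the hereditary subalgebra $\overline{xAx}$; (5) $\|p_1 x p_1\| > 1 - \varepsilon$ and $\|p_2 x p_2\| > 1 - \varepsilon$. *)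

(* Defs.v *)
From HB Require Import structures.
From mathcomp Require Import all_boot all_order all_algebra.
From mathcomp Require Import complex.
From mathcomp Require Import all_classical all_reals topology normedtype.

Set Implicit Arguments.
Unset Strict Implicit.
Unset Printing Implicit Defensive.

Import Order.TTheory GRing.Theory Num.Theory.
Import numFieldNormedType.Exports.

Local Open Scope classical_set_scope.
Local Open Scope complex_scope.
Local Open Scope ring_scope.

(* Unital C*-algebras over the complex field R[i].  The ring operations are
   fields of this structure, and not inherited from GRing.Algebra, because
   Num.NumDomain rules out a common extension of the ring and norm hierarchies;
   the algType R[i] instance is built below.
   The norm of an element takes its values in R[i]: it is a nonnegative
   complex number, hence real, and z < w in R[i] means that 'Im z = 'Im w and
   'Re z < 'Re w. *)
HB.mixin Record isCStarAlgebra (R : realType) (A : Type)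
    & CompleteNormedModule R[i] A := {
  cstar_one : A ;
  cstar_mul : A -> A -> A ;
  star : A -> A ;
  cstar_mulA : associative cstar_mul ;
  cstar_mul1l : left_id cstar_one cstar_mul ;
  cstar_mul1r : right_id cstar_one cstar_mul ;
  cstar_mulDl : left_distributive cstar_mul +%R ;
  cstar_mulDr : right_distributive cstar_mul +%R ;
  cstar_one_neq0 : cstar_one != 0 ;
  cstar_scaleAl : forall (c : R[i]) (x y : A),
    c *: cstar_mul x y = cstar_mul (c *: x) y ;
  cstar_scaleAr : forall (c : R[i]) (x y : A),
    c *: cstar_mul x y = cstar_mul x (c *: y) ;
  starK : involutive star ;
  starD : {morph star : x y / x + y} ;
  starZ : forall (c : R[i]) (x : A), star (c *: x) = Num.conj c *: star x ;
  starM_subproof : forall x y : A,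
    star (cstar_mul x y) = cstar_mul (star y) (star x) ;
  normM_subproof : forall x y : A, `|cstar_mul x y| <= `|x| * `|y| ;
  norm_star_subproof : forall x : A, `|cstar_mul (star x) x| = `|x| ^+ 2
}.

#[short(type="cstarAlgType")]
HB.structure Definition CStarAlgebra (R : realType) :=
  {A of isCStarAlgebra R A & CompleteNormedModule R[i] A}.

Section CStarAlgebraInstances.
Context {R : realType} (A : cstarAlgType R).

HB.instance Definition _ := GRing.Zmodule_isNzRing.Build (CStarAlgebra.sort A)
  (@cstar_mulA R A) (@cstar_mul1l R A) (@cstar_mul1r R A)
  (@cstar_mulDl R A) (@cstar_mulDr R A) (@cstar_one_neq0 R A).

HB.instance Definition _ :=
  GRing.Lmodule_isLalgebra.Build R[i] (CStarAlgebra.sort A)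
    (@cstar_scaleAl R A).

HB.instance Definition _ :=
  GRing.Lalgebra_isAlgebra.Build R[i] (CStarAlgebra.sort A)
    (@cstar_scaleAr R A).

End CStarAlgebraInstances.

Section CStarAlgebraTheory.
Context {R : realType} {A : cstarAlgType R}.
Implicit Types x y : A.

Lemma starM x y : star (x * y) = star y * star x.
Proof. exact: starM_subproof. Qed.

Lemma cstar_normM x y : `|x * y| <= `|x| * `|y|.
Proof. exact: normM_subproof. Qed.

Lemma cstar_norm_star x : `|star x * x| = `|x| ^+ 2.
Proof. exact: norm_star_subproof. Qed.

End CStarAlgebraTheory.

Section CStarNotions.
Context {R : realType} {A : cstarAlgType R}.
Implicit Types (a p q x : A).

Definition finite_dimensional (V : lmodType R[i]) : Prop :=
  exists (n : nat) (e : 'I_n -> V), forall v : V,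
    exists c : 'I_n -> R[i], v = \sum_(i < n) c i *: e i.

Definition separable (T : topologicalType) : Prop :=
  exists D : set T, countable D /\ dense D.

(* Stability under scalars is automatic because A is unital. *)
Definition two_sided_ideal (I : set A) : Prop :=
  [/\ I 0,
      forall x y, I x -> I y -> I (x + y)
    & forall a x, I x -> I (a * x) /\ I (x * a)].

Definition invertible x : Prop := exists y : A, x * y = 1 /\ y * x = 1.

Definition spectrum x : set R[i] := [set l | ~ invertible (l *: 1 - x)].

(* In R[i], 0 <= l means that l is real and nonnegative. *)
Definition positive x : Prop :=
  star x = x /\ (forall l : R[i], spectrum x l -> 0 <= l).

Definition projection p : Prop := star p = p /\ p * p = p.

Definition mvn_equivalent p q : Prop :=
  exists v : A, star v * v = p /\ v * star v = q.

Definition hereditary_subalgebra x : set A :=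
  closure [set x * a * x | a in [set: A]].

Definition mvn_to_projection_in q (B : set A) : Prop :=
  exists e : A, [/\ projection e, B e & mvn_equivalent q e].

End CStarNotions.

Definition simple_cstar (R : realType) (A : cstarAlgType R) : Prop :=
  forall I : set A, two_sided_ideal I -> closed I ->
    I = [set 0] \/ I = [set: A].

Section Automorphisms.
Context {R : realType} (A : cstarAlgType R).

Definition is_star_automorphism (f : A -> A) : Prop :=
  [/\ bijective f,
      forall (c : R[i]) (x y : A), f (c *: x + y) = c *: f x + f y,
      forall x y : A, f (x * y) = f x * f y
    & forall x : A, f (star x) = star (f x)].

Record starAut := StarAut {
  starAut_fun :> A -> A ;
  starAut_subproof : `[< is_star_automorphism starAut_fun >] }.

HB.instance Definition _ := [isSub for starAut_fun].
HB.instance Definition _ := [Choice of starAut by <:].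

Lemma starAutP (f : starAut) : is_star_automorphism f.
Proof. by case: f => f /= /asboolP. Qed.

Lemma starAut_eqP (f g : starAut) : f =1 g -> f = g.
Proof. by move=> fg; apply: val_inj; apply/funext. Qed.

Lemma is_star_automorphism_id : is_star_automorphism id.
Proof. by split => //; exists id. Qed.

Lemma is_star_automorphism_comp (f g : A -> A) :
  is_star_automorphism f -> is_star_automorphism g ->
  is_star_automorphism (f \o g).
Proof.
move=> [bf lf mf sf] [bg lg mg sg]; split => /=.
- exact: bij_comp.
- by move=> c x y; rewrite lg lf.
- by move=> x y; rewrite mg mf.
- by move=> x; rewrite sg sf.
Qed.

Lemma starAut_inv_exists (f : starAut) :
  {g : A -> A | cancel f g /\ cancel g f}.
Proof.
by apply: cid; have [[g fK gK] _ _ _] := starAutP f; exists g.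
Qed.

Definition starAut_inv_fun (f : starAut) : A -> A :=
  sval (starAut_inv_exists f).

Lemma starAut_invK (f : starAut) : cancel f (starAut_inv_fun f).
Proof. exact: (svalP (starAut_inv_exists f)).1. Qed.

Lemma starAut_invKV (f : starAut) : cancel (starAut_inv_fun f) f.
Proof. exact: (svalP (starAut_inv_exists f)).2. Qed.

Lemma is_star_automorphism_inv (f : starAut) :
  is_star_automorphism (starAut_inv_fun f).
Proof.
have [bf lf mf sf] := starAutP f.
have fI := bij_inj bf; have gK := starAut_invKV f.
split.
- by exists f => //; exact: starAut_invK.
- by move=> c x y; apply: fI; rewrite lf !gK.
- by move=> x y; apply: fI; rewrite mf !gK.
- by move=> x; apply: fI; rewrite sf !gK.
Qed.

Definition starAut_one : starAut :=
  StarAut (introT (asboolP _) is_star_automorphism_id).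

Definition starAut_mul (f g : starAut) : starAut :=
  StarAut (introT (asboolP _)
    (is_star_automorphism_comp (starAutP f) (starAutP g))).

Definition starAut_inv (f : starAut) : starAut :=
  StarAut (introT (asboolP _) (is_star_automorphism_inv f)).

Lemma starAut_mulA : associative starAut_mul.
Proof. by move=> f g h; apply: starAut_eqP. Qed.

Lemma starAut_mul1g : left_id starAut_one starAut_mul.
Proof. by move=> f; apply: starAut_eqP. Qed.

Lemma starAut_mulg1 : right_id starAut_one starAut_mul.
Proof. by move=> f; apply: starAut_eqP. Qed.

Lemma starAut_mulVg : left_inverse starAut_one starAut_inv starAut_mul.
Proof. by move=> f; apply: starAut_eqP => x; exact: starAut_invK. Qed.

Lemma starAut_mulgV : right_inverse starAut_one starAut_inv starAut_mul.
Proof. by move=> f; apply: starAut_eqP => x; exact: starAut_invKV. Qed.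

(* The group Aut(A), under composition: (f * g)%g x = f (g x). *)
HB.instance Definition _ := isGroup.Build starAut
  starAut_mulA starAut_mul1g starAut_mulg1 starAut_mulVg starAut_mulgV.

Definition tracially_approx_inner (alpha : starAut) : Prop :=
  forall (F : set A) (eps : R) (x : A),
    finite_set F -> 0 < eps -> positive x -> `|x| = 1 ->
  exists p1 p2 v : A,
  [/\ [/\ projection p1, projection p2,
          star v * v = p1 & v * star v = alpha p2],
      forall a, F a ->
        `|p1 * a - a * p1| < eps%:C /\ `|p2 * a - a * p2| < eps%:C,
      forall a, F a ->
        `|v * p1 * a * p1 * star v - alpha (p2 * a * p2)| < eps%:C,
      mvn_to_projection_in (1 - p1) (hereditary_subalgebra x) /\
      mvn_to_projection_in (1 - p2) (hereditary_subalgebra x)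
    & 1 - eps%:C < `|p1 * x * p1| /\ 1 - eps%:C < `|p2 * x * p2| ].

End Automorphisms.

(* Main.v *)
Require Import Defs.
From Stdlib Require Ncring Ncring_tac.
From mathcomp Require Import all_boot all_order all_algebra.
From mathcomp Require Import complex ring lra.
From mathcomp Require Import all_classical all_reals topology normedtype.

Set Implicit Arguments.
Unset Strict Implicit.
Unset Printing Implicit Defensive.

Import Order.TTheory GRing.Theory Num.Theory.
Import numFieldNormedType.Exports.

Local Open Scope classical_set_scope.
Local Open Scope complex_scope.
Local Open Scope ring_scope.

(** The identity is witnessed by p1 = p2 = v = 1.  If (p1, p2, v) witnesses
    that alpha is tracially approximately inner, then
    (p2, p1, alpha^-1 (star v)) is a witness for alpha^-1: conjugating the
    estimate v a (star v) ~ alpha (p2 a p2) by star v, a contraction, turns it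
    into the estimate for the inverse.  The work is in products.

    Let (q1, q2, w) be a witness for beta, and let (p1, p2, v) be a witness
    for alpha with a much smaller tolerance and with w, Q = beta q2 and the
    images under beta of the given elements among those added to the finite
    set.  Since p1 almost commutes with w and Q, the element star w * p1 * w
    is almost a projection; a projection r <= q1 near it is the source of a
    partial isometry u near v w, and f with (alpha beta) f = u * star u is
    close to the preimage under beta of p2 Q p2 (lemma cut_partial_isometry).
    Two of the defining conditions are not inherited for free.

    - Smallness of 1 - r and 1 - f.  In both cases one defect is dominated by
      1 - q_i and the rest by 1 - p_j.  So beta and alpha are applied to
      orthogonal nonzero elements of the hereditary subalgebra of x; these
      exist because otherwise the algebra would have a minimal projection
      and, being simple and unital, would be finite dimensional
      (lemma orthogonal_pair).  The defect 1 - p2 has to be small after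
      applying beta^-1, whereas 1 - p1 has to be small as it stands: by
      simplicity m = s2 c (beta s2) is nonzero for some c, the hereditary
      subalgebra of m * star m lies in that of s2, and its projections are
      equivalent to projections below beta s2 (lemma sub_swap).

    - The lower bounds on norms.  For positive x of norm 1 they say no more than
      that the projections do not vanish: a nonzero projection p that almost
      commutes with a suitable finite set satisfies
      norm (p x p) > 1 - eps (lemma central_compression).  This is the
      fact that the injective homomorphism a |-> p a of a simple C*-algebra
      into a sequence algebra is isometric.  Hence the property is equivalent
      to central_tai, in which the lower bounds are replaced by p1 != 0 and
      which passes to products.

    The facts about C*-algebras that this uses are derived from the axioms
    without Gelfand theory.  The key is that a self-adjoint element attains
    its norm on its spectrum (lemma sa_spectrum_norm); square roots come from
    an iteration, positivity of star m * m from the argument of Fukamiya and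
    Kaplansky. *)

(** * Identities in noncommutative rings *)

Section NcRing.
Context {R : realType} {A : cstarAlgType R}.

#[local] Instance cstar_ring_ops : @Ncring.Ring_ops A 0 1 +%R *%R
  (fun x y => x - y) -%R (@eq A) := {}.

#[local] Instance cstar_ncring : @Ncring.Ring A 0 1 +%R *%R
  (fun x y => x - y) -%R (@eq A) cstar_ring_ops.
Proof.
split; rewrite /Algebra_syntax.equality /Ncring.eq_notation /=.
- exact: RelationClasses.eq_equivalence.
- by move=> ? ? -> ? ? ->.
- by move=> ? ? -> ? ? ->.
- by move=> ? ? -> ? ? ->.
- by move=> ? ? ->.
- exact: add0r.
- exact: addrC.
- exact: addrA.
- exact: mul1r.
- exact: mulr1.
- exact: mulrA.
- exact: mulrDl.
- by move=> *; exact: mulrDr.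
- by [].
- exact: subrr.
Qed.

End NcRing.
#[local] Existing Instance cstar_ring_ops.
#[local] Existing Instance cstar_ncring.
Ltac ncring := Ncring_tac.non_commutative_ring.

(** * Real-valued norm, real scalars and limits *)

Section Norm.
Context {R : realType} {A : cstarAlgType R}.
Implicit Types (x y z : A) (r : R).

(** The norm takes values in R[i], which is only partially ordered; its real
    part lives in a field where linear arithmetic applies. *)
Definition nrm x : R := complex.Re `|x|.

Lemma nrmE x : `|x| = (nrm x)%:C.
Proof.
have : 0 <= `|x| by exact: normr_ge0.
by rewrite /nrm; case: `|x| => a b; rewrite lecE /= => /andP[/eqP -> _].
Qed.

Lemma nrm_ge0 x : 0 <= nrm x.
Proof. by rewrite -(@lecR R) -nrmE normr_ge0. Qed.

Lemma nrm_eq0 x : nrm x = 0 -> x = 0.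
Proof. by move=> x0; apply/eqP; rewrite -normr_eq0 nrmE x0. Qed.

Lemma nrm0 : nrm 0 = 0.
Proof. by rewrite /nrm normr0. Qed.

Lemma nrmN x : nrm (- x) = nrm x.
Proof. by rewrite /nrm normrN. Qed.

Lemma nrm_sub x y : nrm (x - y) = nrm (y - x).
Proof. by rewrite /nrm distrC. Qed.

Lemma nrmD x y : nrm (x + y) <= nrm x + nrm y.
Proof. by rewrite -(@lecR R) rmorphD /= -!nrmE ler_normD. Qed.

Lemma nrmB x y : nrm (x - y) <= nrm x + nrm y.
Proof. by rewrite -(nrmN y) nrmD. Qed.

Lemma nrmM x y : nrm (x * y) <= nrm x * nrm y.
Proof. by rewrite -(@lecR R) rmorphM /= -!nrmE cstar_normM. Qed.

Lemma nrm_starl x : nrm (star x * x) = nrm x ^+ 2.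
Proof. by apply: complexI; rewrite rmorphXn /= -!nrmE cstar_norm_star. Qed.

Lemma star0 : star (0 : A) = 0.
Proof. by apply: (@addrI _ (star (0 : A))); rewrite -starD !addr0. Qed.

Lemma starN x : star (- x) = - star x.
Proof. by apply/eqP; rewrite -addr_eq0 -starD addNr star0. Qed.

Lemma starB x y : star (x - y) = star x - star y.
Proof. by rewrite starD starN. Qed.

Lemma star1 : star (1 : A) = 1.
Proof. by have := starM (star 1) (1 : A); rewrite mulr1 starK mulr1. Qed.

Lemma nrm_gt0 x : x != 0 -> 0 < nrm x.
Proof. by move=> x0; rewrite -(@ltcR R) -nrmE normr_gt0. Qed.

(** Norm invariance of the involution follows from the C*-identity, as
    norm y ^ 2 = norm (star y * y) <= norm (star y) * norm y. *)
Lemma nrm_star x : nrm (star x) = nrm x.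
Proof.
suff H y : nrm y <= nrm (star y) by apply/eqP; rewrite eq_le -{2}(starK x) !H.
have [->|y0] := eqVneq y 0; first by rewrite star0.
by rewrite -(ler_pM2r (nrm_gt0 y0)) -expr2 -nrm_starl nrmM.
Qed.

Lemma nrm_starr x : nrm (x * star x) = nrm x ^+ 2.
Proof. by rewrite -{1}(starK x) nrm_starl nrm_star. Qed.

Lemma nrm1 : nrm (1 : A) = 1.
Proof.
have := nrm_starl 1; rewrite star1 mulr1 expr2.
have /lt0r_neq0 n0 : 0 < nrm (1 : A) by rewrite nrm_gt0 ?oner_neq0.
by move=> H; apply: (mulIf n0); rewrite mul1r -H.
Qed.

Lemma nrm_sa x : star x = x -> nrm (x * x) = nrm x ^+ 2.
Proof. by move=> xs; rewrite -{1}xs nrm_starl. Qed.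

(** Real scalars are kept as central elements of the algebra, so that the
    decision procedure for noncommutative rings treats them as atoms. *)
Definition rc r : A := (r%:C)%:A.

Lemma rc0 : rc 0 = 0. Proof. by rewrite /rc scale0r. Qed.
Lemma rc1 : rc 1 = 1. Proof. by rewrite /rc scale1r. Qed.
Lemma rcD r s : rc (r + s) = rc r + rc s.
Proof. by rewrite /rc rmorphD scalerDl. Qed.
Lemma rcN r : rc (- r) = - rc r.
Proof. by rewrite /rc rmorphN scaleNr. Qed.
Lemma rcB r s : rc (r - s) = rc r - rc s.
Proof. by rewrite rcD rcN. Qed.
Lemma rcM r s : rc (r * s) = rc r * rc s.
Proof. by rewrite /rc rmorphM -scalerAl mul1r scalerA. Qed.
Lemma rcC r x : rc r * x = x * rc r.
Proof. by rewrite /rc -scalerAl mul1r -scalerAr mulr1. Qed.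
Lemma rcV r : r != 0 -> rc r * rc r^-1 = 1.
Proof. by move=> r0; rewrite -rcM divff // rc1. Qed.
Lemma star_rc r : star (rc r) = rc r.
Proof. by rewrite /rc starZ star1; congr (_ *: _); exact: conjc_real. Qed.

Lemma nrm_rcM r x : nrm (rc r * x) = `|r| * nrm x.
Proof.
apply: complexI; rewrite /rc -scalerAl mul1r -nrmE normrZ rmorphM /= -nrmE.
by congr (_ * _); rewrite normc_def /= expr0n addr0 sqrtr_sqr.
Qed.

Lemma nrm_rc r : nrm (rc r) = `|r|.
Proof. by rewrite -(mulr1 (rc r)) nrm_rcM nrm1 mulr1. Qed.

Lemma nrm_normalize x : x != 0 -> nrm (rc (nrm x)^-1 * x) = 1.
Proof.
move=> /nrm_gt0 x0; rewrite nrm_rcM ger0_norm ?mulVf ?gt_eqF //.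
by rewrite invr_ge0 ltW.
Qed.

Lemma closureP (B : set A) x :
  closure B x <-> forall e, 0 < e -> exists2 y, B y & nrm (y - x) < e.
Proof.
split=> [cx e e0|H V].
  have /cx [y [By]] : nbhs x (ball x e%:C) by apply: nbhsx_ballx; rewrite ltcR.
  by rewrite -ball_normE /= nrmE ltcR nrm_sub => ?; exists y.
rewrite -nbhs_ballE => -[e /= e0 eV].
have eE : e = (complex.Re e)%:C.
  by move: e0; case: (e) => a b; rewrite ltcE /= => /andP[/eqP -> _].
move: e0; rewrite eE ltcR => e0.
have [y By yx] := H _ e0; exists y; split => //; apply: eV.
by rewrite -ball_normE /= nrmE eE ltcR nrm_sub.
Qed.

(** The convergence criterion for both iterations below: the increments of u
    are dominated by those of a bounded real sequence. *)
Lemma majorized_cvg (u : nat -> A) (d : nat -> R) (M : R) :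
  (forall n, nrm (u n.+1 - u n) <= d n.+1 - d n) -> (forall n, d n <= M) ->
  exists l, forall e, 0 < e -> exists N, forall n, (N <= n)%N -> nrm (u n - l) < e.
Proof.
move=> ud dM.
have dmono : {homo d : n m / (n <= m)%N >-> n <= m}.
  apply: homo_leq; [exact: lexx|exact: le_trans|move=> n].
  by rewrite -subr_ge0 (le_trans (nrm_ge0 _) (ud n)).
have udd n k : nrm (u (n + k)%N - u n) <= d (n + k)%N - d n.
  elim: k => [|k IH]; first by rewrite addn0 !subrr nrm0.
  rewrite addnS; have -> : u (n + k).+1 - u n =
    (u (n + k).+1 - u (n + k)%N) + (u (n + k)%N - u n) by rewrite addrA subrK.
  have := nrmD (u (n + k).+1 - u (n + k)%N) (u (n + k)%N - u n).
  have := ud (n + k)%N; lra.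
have sup_d : has_sup (range d).
  by split; [exists (d 0%N); exists 0%N | exists M => _ [n _ <-]].
have tail e : 0 < e -> exists N, forall n k, (N <= n)%N ->
    nrm (u (n + k)%N - u n) < e.
  move=> e0; have [_ [N _ <-] HN] := sup_adherent e0 sup_d.
  exists N => n k Nn; apply: (le_lt_trans (udd n k)).
  have := dmono _ _ Nn; have : d (n + k)%N <= sup (range d).
    by apply: ub_le_sup; [case: sup_d | exists (n + k)%N].
  lra.
have cu : cvg (u @ \oo).
  apply: cauchy_cvg; apply/cauchyP => e e0.
  have eE : e = (complex.Re e)%:C.
    by move: e0; case: (e) => a b; rewrite ltcE /= => /andP[/eqP -> _].
  move: e0; rewrite eE ltcR => e0; have [N HN] := tail _ e0.
  exists (u N); exists N => // n /= Nn; rewrite -ball_normE /= nrmE ltcR nrm_sub.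
  by rewrite -(subnKC Nn); apply: HN.
exists (lim (u @ \oo)) => e e0.
have /cvgrPdist_lt /(_ e%:C) := cu; rewrite ltcR => /(_ e0) [N _ HN]; exists N => n Nn.
by have := HN n Nn; rewrite /= nrmE ltcR nrm_sub.
Qed.

End Norm.

(** * Invertible elements and Neumann series *)

Section Spectrum.
Context {R : realType} {A : cstarAlgType R}.
Implicit Types (x y z h t : A) (r : R).

Lemma invertible_lr x y z : x * y = 1 -> z * x = 1 -> invertible x.
Proof.
move=> xy zx; exists y; split => //.
by have -> : y = z by rewrite -(mul1r y) -zx -mulrA xy mulr1.
Qed.

Lemma invertibleM x y : invertible x -> invertible y -> invertible (x * y).
Proof.
move=> [x' [xx' x'x]] [y' [yy' y'y]]; exists (y' * x'); split.
  by rewrite mulrA -(mulrA x) yy' mulr1.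
by rewrite mulrA -(mulrA y') x'x mulr1.
Qed.

Lemma invertible_commM x y : x * y = y * x -> invertible (x * y) -> invertible x.
Proof.
move=> xy [w [xyw wxy]]; apply: (@invertible_lr _ (y * w) (w * y)).
  by rewrite mulrA.
by rewrite -mulrA -xy.
Qed.

Lemma invertibleN x : invertible x -> invertible (- x).
Proof. by move=> [y [xy yx]]; exists (- y); rewrite !mulrNN. Qed.

Lemma invertible_scale (c : R[i]) x : c != 0 -> invertible x -> invertible (c *: x).
Proof.
move=> c0 [y [xy yx]]; exists (c^-1 *: y).
by rewrite -!scalerAl -!scalerAr !scalerA xy yx mulfV // mulVf // scale1r.
Qed.

Lemma invertible_rcM r x : r != 0 -> invertible x -> invertible (rc r * x).
Proof.
move=> r0 ix; rewrite /rc -scalerAl mul1r; apply: invertible_scale => //.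
by rewrite eq_complex /= negb_and r0.
Qed.

Lemma not_invertible0 : ~ invertible (0 : A).
Proof. by move=> [y []]; rewrite mul0r => /eqP; rewrite eq_sym oner_eq0. Qed.

(** The inverse is the limit of the iteration y |-> 1 + t y started at 0,
    majorized by the geometric series of norm t. *)
Lemma neumann t : nrm t < 1 -> invertible (1 - t).
Proof.
move=> t1; pose u := fix u n : A := if n is m.+1 then 1 + t * u m else 0.
pose d := fix d n : R := if n is m.+1 then 1 + nrm t * d m else 0.
have uE n : u n.+1 = 1 + t * u n by [].
have dE n : d n.+1 = 1 + nrm t * d n by [].
have t0 := nrm_ge0 t.
have dle n : d n <= (1 - nrm t)^-1.
  elim: n => [|n IH]; first by rewrite invr_ge0 /=; lra.
  have s0 : 0 < 1 - nrm t by lra.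
  rewrite dE -(ler_pM2l s0) mulfV ?gt_eqF //.
  have {}IH : (1 - nrm t) * d n <= 1 by rewrite mulrC -ler_pdivlMr // div1r.
  have : nrm t * ((1 - nrm t) * d n) <= nrm t * 1 by apply: ler_wpM2l.
  lra.
have ud n : nrm (u n.+1 - u n) <= d n.+1 - d n.
  elim: n => [|n IH].
    by rewrite uE dE /= !mulr0 !subr0 !addr0 nrm1.
  have -> : u n.+2 - u n.+1 = t * (u n.+1 - u n).
    by rewrite (uE n.+1) (uE n); ncring.
  have -> : d n.+2 - d n.+1 = nrm t * (d n.+1 - d n).
    by rewrite (dE n.+1) (dE n); ring.
  by apply: (le_trans (nrmM _ _)); exact: ler_wpM2l.
have [l ul] := majorized_cvg ud dle.
have ut n : t * u n = u n * t.
  elim: n => [|n IH]; first by rewrite /= mulr0 mul0r.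
  by rewrite uE mulrDr mulrDl mulr1 mul1r -mulrA -IH.
have small x : (forall e, 0 < e -> nrm x <= e * 2) -> x = 0.
  move=> H; apply: nrm_eq0; apply/eqP; rewrite eq_le nrm_ge0 andbT.
  rewrite leNgt; apply/negP => x0; have := H (nrm x / 4%:R).
  by lra.
exists l; split; apply/eqP; rewrite -subr_eq0; apply/eqP; apply: small => e e0.
  have [N HN] := ul e e0.
  have := HN N.+1 (leqnSn _); have := HN N (leqnn _).
  rewrite uE => H1 H2.
  have -> : (1 - t) * l - 1 = t * (u N - l) - (1 + t * u N - l) by ncring.
  apply: (le_trans (nrmB _ _)); have := nrmM t (u N - l).
  have : nrm t * nrm (u N - l) <= 1 * nrm (u N - l).
    by rewrite ler_wpM2r ?nrm_ge0 // ltW.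
  lra.
have [N HN] := ul e e0.
have := HN N.+1 (leqnSn _); have := HN N (leqnn _).
rewrite uE ut => H1 H2.
have -> : l * (1 - t) - 1 = (u N - l) * t - (1 + u N * t - l) by ncring.
apply: (le_trans (nrmB _ _)); have := nrmM (u N - l) t.
have : nrm (u N - l) * nrm t <= nrm (u N - l) * 1.
  by rewrite ler_wpM2l ?nrm_ge0 // ltW.
lra.
Qed.

Lemma invertible_near1 x : nrm (x - 1) < 1 -> invertible x.
Proof.
move=> x1; have -> : x = 1 - (1 - x) by ncring.
by apply: neumann; rewrite nrm_sub.
Qed.

Definition modc (c : R[i]) : R := complex.Re `|c|.

Lemma modcE c : `|c| = (modc c)%:C.
Proof. by rewrite /modc normc_def. Qed.

Lemma modc_sqr (a b : R) : modc (a +i* b) ^+ 2 = a ^+ 2 + b ^+ 2.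
Proof.
by rewrite /modc normc_def /= sqr_sqrtr // addr_ge0 ?sqr_ge0.
Qed.

Lemma modc_ge0 c : 0 <= modc c.
Proof. by rewrite /modc normc_def /= sqrtr_ge0. Qed.

Lemma nrmZ (c : R[i]) x : nrm (c *: x) = modc c * nrm x.
Proof. by apply: complexI; rewrite rmorphM /= -!nrmE -modcE normrZ. Qed.

Lemma spectrum_modc (c : R[i]) x : nrm x < modc c -> invertible (c%:A - x).
Proof.
move=> xc; have c0 : c != 0.
  apply/eqP => c0; move: xc; rewrite c0 /modc normr0 /=.
  by rewrite ltNge nrm_ge0.
have -> : c%:A - x = c *: (1 - c^-1 *: x).
  by rewrite scalerBr scalerA mulfV // scale1r.
apply: invertible_scale => //; apply: neumann; rewrite nrmZ.
have c0' : 0 < modc c by apply: le_lt_trans xc; exact: nrm_ge0.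
have -> : modc c^-1 = (modc c)^-1.
  by apply: complexI; rewrite -modcE normfV modcE fmorphV.
by rewrite mulrC ltr_pdivrMr // mul1r.
Qed.

Lemma rc_invertible r x : nrm x < `|r| -> invertible (rc r - x).
Proof.
move=> xr; apply: spectrum_modc; apply: (lt_le_trans xr).
by rewrite /modc normc_def /= expr0n addr0 sqrtr_sqr.
Qed.

(** The imaginary unit as a central element, for the same reason as rc. *)
Definition imag : A := ('i : R[i])%:A.

Lemma imagC x : imag * x = x * imag.
Proof. by rewrite /imag -scalerAl mul1r -scalerAr mulr1. Qed.

Lemma imag2 : imag * imag = - 1.
Proof. by rewrite /imag -scalerAl mul1r scalerA -expr2 sqr_i scaleN1r. Qed.

Lemma star_imag : star imag = - imag.
Proof. by rewrite /imag starZ star1 -scaleNr; congr (_ *: _); rewrite conjCi. Qed.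

Lemma complex_scalar (a b : R) : (a +i* b)%:A = rc a + imag * rc b.
Proof.
rewrite /rc /imag -scalerAl mul1r scalerA -scalerDl; congr (_ *: _).
exact: (complexE (a +i* b)).
Qed.

(** Because a and b commute, a + i b is normal with absolute value squared
    a ^ 2 + b ^ 2; the C*-identity does the rest. *)
Lemma nrm_re_im a b s : star a = a -> star b = b -> a * b = b * a ->
  nrm (s * (a + imag * b)) ^+ 2 = nrm (s * (a * a + b * b) * star s).
Proof.
move=> sa sb ab; rewrite -nrm_starr starM starD starM star_imag sa sb.
have -> : s * (a + imag * b) * ((a + b * - imag) * star s) =
    s * (a * a + (imag * (b * a) - a * b * imag) - imag * (b * b) * imag) * star s.
  by ncring.
by rewrite ab (imagC (b * a)) subrr addr0 (imagC (b * b)) -(mulrA (b * b)) imag2 mulrN1 opprK.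
Qed.

End Spectrum.

(** * A self-adjoint element attains its norm on the spectrum *)

Section SelfAdjoint.
Context {R : realType} {A : cstarAlgType R}.
Implicit Types (x y z h t a b : A) (r : R).

(** The classical trick: a spectral value a + i b of h gives the value
    a + i (b + s) of h + i s for every real s, hence
    a ^ 2 + (b + s) ^ 2 <= norm h ^ 2 + s ^ 2, absurd when b s is large. *)
Lemma sa_spectrum_real h (l : R[i]) : star h = h ->
  complex.Im l != 0 -> invertible (l%:A - h).
Proof.
move=> sh; case: l => a b /= b0; pose N := nrm h.
(* This shift makes the cross term 2 b s equal to N ^ 2 + 1. *)
pose s := (N ^+ 2 + 1) / (2 * b).
have -> : (a +i* b)%:A - h = (a +i* (b + s))%:A - (h + imag * rc s).
  by rewrite !complex_scalar rcD; ncring.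
apply: spectrum_modc.
rewrite -(ltr_pXn2r (n := 2)) ?nnegrE ?nrm_ge0 ?modc_ge0 //.
have := nrm_re_im 1 sh (star_rc s) (esym (rcC s h)).
rewrite star1 !mul1r mulr1 => ->; rewrite modc_sqr.
apply: (le_lt_trans (nrmD _ _)).
rewrite -rcM nrm_rc nrm_sa // -/N ger0_norm -?expr2 ?sqr_ge0 //.
have -> : (b + s) ^+ 2 = b ^+ 2 + (N ^+ 2 + 1) + s ^+ 2.
  by rewrite /s; field.
have := sqr_ge0 a; have := sqr_ge0 b; lra.
Qed.

Lemma star_exp t n : star t = t -> star (t ^+ n) = t ^+ n.
Proof.
move=> st; elim: n => [|m IHm]; first by rewrite expr0 star1.
by rewrite {1}exprS starM IHm st -exprSr.
Qed.

Lemma nrm_sa_pow t n : star t = t -> nrm t = 1 -> nrm (t ^+ n) = 1.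
Proof.
move=> st t1.
have p2 k : nrm (t ^+ (2 ^ k)) = 1.
  elim: k => [|k IH]; first by rewrite expr1.
  by rewrite expnS mul2n -addnn exprD nrm_sa ?star_exp // IH expr1n.
have le1 k : nrm (t ^+ k) <= 1.
  elim: k => [|k IH]; first by rewrite expr0 nrm1.
  by rewrite exprS (le_trans (nrmM _ _)) // t1 mul1r.
apply/eqP; rewrite eq_le le1 /=.
have nn : (n <= 2 ^ n)%N by rewrite ltnW // ltn_expl.
rewrite -(p2 n) -{1}(subnKC nn) exprD (le_trans (nrmM _ _)) //.
by rewrite ler_piMr ?nrm_ge0.
Qed.

(** A substitute for monotonicity of the norm on positive elements, available
    before positivity is: a is the mean of a + i b and a - i b, which have the
    same norm even after multiplication by s. *)
Lemma nrm_dominate s a b : star a = a -> star b = b -> a * b = b * a ->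
  nrm (s * a) ^+ 2 <= nrm (s * (a * a + b * b) * star s).
Proof.
move=> sa sb ab.
have e1 := nrm_re_im s sa sb ab.
have sNb : star (- b) = - b by rewrite starN sb.
have abN : a * - b = - b * a by rewrite mulrN mulNr ab.
have e2 := nrm_re_im s sa sNb abN; rewrite mulrNN in e2.
have e12 : nrm (s * (a + imag * - b)) = nrm (s * (a + imag * b)).
  apply/eqP; rewrite -(eqrXn2 (n := 2)) ?nrm_ge0 //.
  by rewrite e1 e2.
rewrite -e1 lerXn2r ?nnegrE ?nrm_ge0 //.
have := nrmD (s * (a + imag * - b)) (s * (a + imag * b)).
rewrite e12 -mulrDr.
have -> : a + imag * - b + (a + imag * b) = a + a by ncring.
rewrite mulrDr.
have -> : s * a + s * a = rc 2 * (s * a) by rewrite rcD rc1 mulrDl mul1r.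
rewrite nrm_rcM ger0_norm //; lra.
Qed.

(** This replaces the spectral radius formula.  The partial products of
    1 / (1 - t ^ 4) = prod_j (1 + t ^ (4 2 ^ j)) would stay bounded if
    1 - t ^ 4 were invertible.  But 1 + s ^ 2 = 2 s + (1 - s) ^ 2 dominates
    2 s when s = t ^ (2 2 ^ j) is a square, so the k-th partial product has
    norm at least 2 ^ k. *)
Lemma sa_norm1_noninv t : star t = t -> nrm t = 1 -> ~ invertible (1 - t ^+ 4).
Proof.
move=> st t1 [K [_ Ktl]].
pose sg k := t ^+ (2 ^ k); pose s k := sg k * sg k.
pose C := fix C k : A := if k is m.+1 then C m * (1 + imag * s m) else 1.
have CE k : C k.+1 = C k * (1 + imag * s k) by [].
have comm m n : t ^+ m * t ^+ n = t ^+ n * t ^+ m by rewrite -!exprD addnC.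
have sn k n : s k * t ^+ n = t ^+ n * s k by rewrite /s /sg -!exprD addnC.
have isn k n : (1 + imag * s k) * t ^+ n = t ^+ n * (1 + imag * s k).
  rewrite mulrDl mulrDr mul1r mulr1; congr (_ + _).
  by rewrite -mulrA sn mulrA imagC -mulrA.
have Ct k n : C k * t ^+ n = t ^+ n * C k.
  elim: k => [|k IH]; first by rewrite mul1r mulr1.
  by rewrite CE mulrA -IH -!mulrA isn.
have ss k : star (s k) = s k by rewrite starM star_exp.
have low k n : 2 ^+ k <= nrm (C k * t ^+ n) ^+ 2.
  elim: k n => [|k IH] n; first by rewrite mul1r nrm_sa_pow // expr1n.
  rewrite CE -mulrA isn mulrA (@nrm_re_im R A 1 (s k)) ?star1 ?mul1r ?mulr1 //.
  pose q : R := Num.sqrt 2.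
  pose a := rc q * (sg k * t ^+ n); pose b := (1 - s k) * t ^+ n.
  have cs : sg k * t ^+ n = t ^+ n * sg k by rewrite comm.
  have cb m : (1 - s k) * t ^+ m = t ^+ m * (1 - s k).
    by rewrite mulrBl mulrBr mul1r mulr1 sn.
  have sa : star a = a.
    by rewrite /a 2!starM star_rc !star_exp // -cs rcC.
  have sb : star b = b by rewrite /b starM starB star1 ss star_exp // cb.
  have ab : a * b = b * a.
    rewrite /a -mulrA; suff -> : sg k * t ^+ n * b = b * (sg k * t ^+ n).
      by rewrite rcC -mulrA -rcC.
    by rewrite /b /sg -exprD mulrA -cb -!mulrA comm.
  have key : t ^+ n * (1 + s k * s k) * t ^+ n = a * a + b * b.
    have -> : a * a = rc q * rc q * (sg k * t ^+ n * (sg k * t ^+ n)).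
      rewrite /a; set u := sg k * _.
      by rewrite -mulrA (mulrA u) -(rcC q u) -(mulrA (rc q) u) !mulrA.
    have -> : rc q * rc q = 1 + 1 :> A.
      by rewrite -rcM -expr2 sqr_sqrtr // rcD rc1.
    rewrite mulrDl mul1r.
    have -> : sg k * t ^+ n * (sg k * t ^+ n) = t ^+ n * s k * t ^+ n.
      by rewrite {1}cs /s !mulrA.
    by rewrite /b {1}cb; ncring.
  have := nrm_dominate (C k) sa sb ab; rewrite -key.
  have -> : C k * a = rc q * (C k * (t ^+ (2 ^ k + n))).
    by rewrite /a /sg -exprD mulrA -(rcC q) -mulrA.
  rewrite nrm_rcM exprMn real_normK ?num_real ?sqr_sqrtr //.
  have := IH (2 ^ k + n)%N; rewrite [2 ^+ k.+1]exprS => h1 h2.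
  suff -> : nrm (C k * t ^+ n * (1 + s k * s k) * star (C k * t ^+ n)) =
     nrm (C k * (t ^+ n * (1 + s k * s k) * t ^+ n) * star (C k)) by lra.
  by rewrite starM star_exp // !mulrA.
have prod k : (1 - t ^+ 4) * (C k * star (C k)) = 1 - t ^+ (4 * 2 ^ k).
  elim: k => [|k IH]; first by rewrite /= star1 !mulr1.
  rewrite CE starM starD star1 starM ss star_imag.
  rewrite -(mulrA (C k)) (mulrA (1 + imag * s k)).
  have -> : (1 + imag * s k) * (1 + s k * - imag) = 1 + s k * s k.
    have -> : (1 + imag * s k) * (1 + s k * - imag) =
      1 + (imag * s k - s k * imag) - imag * (s k * s k) * imag by ncring.
    by rewrite imagC subrr addr0 imagC -mulrA imag2 mulrN1 opprK.
  have -> : (1 + s k * s k) * star (C k) = star (C k) * (1 + s k * s k).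
    have -> : s k * s k = t ^+ (4 * 2 ^ k).
      by rewrite /s /sg -!exprD; congr (_ ^+ _); ring.
    have := congr1 star (Ct k (4 * 2 ^ k)%N); rewrite !starM star_exp // => e.
    by rewrite mulrDl mulrDr e mul1r mulr1.
  rewrite (mulrA (C k)) (mulrA (1 - t ^+ 4)) IH.
  have -> : s k * s k = t ^+ (4 * 2 ^ k).
    by rewrite /s /sg -!exprD; congr (_ ^+ _); ring.
  rewrite expnS mulnCA mul2n -addnn exprD; ncring.
have bnd k : 2 ^+ k <= nrm K * 2.
  have := low k 0%N; rewrite expr0 mulr1 -nrm_starr => h1.
  apply: (le_trans h1).
  have -> : C k * star (C k) = K * (1 - t ^+ (4 * 2 ^ k)).
    by rewrite -prod mulrA Ktl mul1r.
  apply: (le_trans (nrmM _ _)); rewrite ler_wpM2l ?nrm_ge0 //.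
  apply: (le_trans (nrmB _ _)); rewrite nrm1 nrm_sa_pow //; lra.
have K0 : 0 <= nrm K * 2 by rewrite mulr_ge0 ?nrm_ge0.
have := archi_boundP K0; set m := Num.bound _ => hm.
have := bnd m; rewrite leNgt => /negP; apply.
apply: (lt_le_trans hm); rewrite -natrX ler_nat ltnW // ltn_expl //.
Qed.

(** With t = h / norm h, factor 1 - t ^ 4 = (1 - t) (1 + t) (1 + t ^ 2); the
    last factor is invertible because the spectrum of t is real. *)
Lemma sa_spectrum_norm h : star h = h ->
  ~ invertible (rc (nrm h) - h) \/ ~ invertible (rc (- nrm h) - h).
Proof.
move=> sh; have [->|h0] := eqVneq h 0.
  by left; rewrite nrm0 rc0 subr0; exact: not_invertible0.
apply/not_andP => -[i1 i2].
have N0 := nrm_gt0 h0; set N := nrm h in i1 i2 N0.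
pose t := rc N^-1 * h.
have st : star t = t by rewrite /t starM star_rc sh -rcC.
apply: (@sa_norm1_noninv t st (nrm_normalize h0)).
have -> : 1 - t ^+ 4 = (1 - t) * ((1 + t) * (1 + t * t)).
  by rewrite !exprS expr0; ncring.
have N1 : N^-1 != 0 by rewrite invr_neq0 // gt_eqF.
have hN : rc N^-1 * rc N = 1 :> A by rewrite -rcM mulVf ?rc1 // gt_eqF.
apply: invertibleM; last apply: invertibleM.
- have -> : 1 - t = rc N^-1 * (rc N - h) by rewrite mulrBr hN.
  exact: invertible_rcM.
- have -> : 1 + t = - (rc N^-1 * (rc (- N) - h)).
    by rewrite mulrBr rcN mulrN hN opprB opprK addrC.
  by apply: invertibleN; exact: invertible_rcM.
have -> : 1 + t * t = ((0 +i* 1)%:A - t) * ((0 +i* (- 1))%:A - t).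
  rewrite !complex_scalar rc0 rcN rc1 !add0r mulr1 mulrN1.
  have -> : (imag - t) * (- imag - t) = - (imag * imag) - (imag * t - t * imag) + t * t.
    by ncring.
  by rewrite imag2 imagC subrr subr0 opprK.
by apply: invertibleM; apply: sa_spectrum_real => //=; rewrite ?oppr_eq0 oner_eq0.
Qed.

End SelfAdjoint.

(** * Positive elements and square roots *)

Section Positivity.
Context {R : realType} {A : cstarAlgType R}.
Implicit Types (x y z h k t a b c d m : A) (r M : R) (P : A -> Prop).

Lemma positive_inv h r : positive h -> r < 0 -> invertible (rc r - h).
Proof.
move=> [_ H] r0; apply: contrapT => ni.
by have := H r%:C ni; rewrite lecR leNgt r0.
Qed.

Lemma positiveP h : star h = h -> (forall r, r < 0 -> invertible (rc r - h)) ->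
  positive h.
Proof.
move=> sh H; split=> // l /= nl.
have [il|il] := eqVneq (complex.Im l) 0; last first.
  by exfalso; apply: nl; exact: sa_spectrum_real.
have lE : l = (complex.Re l)%:C by case: l il {nl} => a b /= ->.
rewrite lE lecR leNgt; apply/negP => l0; apply: nl.
by rewrite lE; exact: H.
Qed.

(** A norm criterion for positivity, convenient because it is additive.  With
    positive_norm it characterizes positive elements. *)
Lemma positive_of_norm h M : star h = h -> nrm (rc M - h) <= M -> positive h.
Proof.
move=> sh hM; apply: positiveP => // r r0.
have -> : rc r - h = - (rc (M - r) - (rc M - h)) by rewrite rcB; ncring.
apply: invertibleN; apply: rc_invertible; apply: (le_lt_trans hM).
have M0 := le_trans (nrm_ge0 _) hM.
by rewrite ger0_norm; lra.
Qed.

Lemma positive_norm h M : positive h -> nrm h <= M -> nrm (rc M - h) <= M.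
Proof.
move=> ph hM; have [sh _] := ph; set y := rc M - h.
have sy : star y = y by rewrite starB star_rc sh.
have N0 := nrm_ge0 y; have h0 := nrm_ge0 h.
case: (sa_spectrum_norm sy) => [ni|ni].
  rewrite leNgt; apply/negP => lt; apply: ni.
  have -> : rc (nrm y) - y = - (rc (M - nrm y) - h) by rewrite rcB /y; ncring.
  by apply: invertibleN; apply: positive_inv => //; lra.
rewrite leNgt; apply/negP => lt; apply: ni.
have -> : rc (- nrm y) - y = - (rc (M + nrm y) - h).
  by rewrite rcD rcN {2}/y; ncring.
by apply: invertibleN; apply: rc_invertible; rewrite ger0_norm; lra.
Qed.

Lemma positive_sa h : positive h -> star h = h. Proof. by case. Qed.

Lemma positiveD x y : positive x -> positive y -> positive (x + y).
Proof.
move=> px py; apply: (@positive_of_norm _ (nrm x + nrm y)).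
  by rewrite starD !positive_sa.
have -> : rc (nrm x + nrm y) - (x + y) = (rc (nrm x) - x) + (rc (nrm y) - y).
  by rewrite rcD; ncring.
by apply: (le_trans (nrmD _ _)); apply: lerD; exact: positive_norm.
Qed.

Lemma positive_rcM r x : 0 <= r -> positive x -> positive (rc r * x).
Proof.
move=> r0 px; have sx := positive_sa px.
apply: (@positive_of_norm _ (r * nrm x)).
  by rewrite starM sx star_rc rcC.
rewrite rcM -mulrBr nrm_rcM ger0_norm // ler_wpM2l //.
exact: positive_norm.
Qed.

Lemma positive_rc_sub h M : star h = h -> nrm h <= M -> positive (rc M - h).
Proof.
move=> sh hM; apply: (@positive_of_norm _ M).
  by rewrite starB star_rc sh.
by rewrite opprB addrCA subrr addr0.
Qed.

Lemma positive_rc r : 0 <= r -> positive (rc r : A).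
Proof.
move=> r0; apply: (@positive_of_norm _ r); rewrite ?star_rc //.
by rewrite subrr nrm0.
Qed.

Lemma positive_sqr h : star h = h -> positive (h * h).
Proof.
move=> sh; apply: positiveP => [|r r0]; first by rewrite starM sh.
pose s := Num.sqrt (- r).
have s0 : s != 0 by rewrite sqrtr_eq0 -ltNge; lra.
have -> : rc r - h * h = - (((0 +i* s)%:A - h) * ((0 +i* (- s))%:A - h)).
  rewrite !complex_scalar rc0 rcN !add0r mulrN.
  have -> : (imag * rc s - h) * (- (imag * rc s) - h) =
    - (imag * (rc s * imag) * rc s) - (imag * (rc s * h) - h * (imag * rc s)) + h * h.
    by ncring.
  have -> : h * (imag * rc s) = imag * (rc s * h) by rewrite mulrA -imagC -mulrA -rcC.
  rewrite -(imagC (rc s)) (mulrA imag) imag2 mulN1r mulNr opprK subrr subr0.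
  have -> : rc s * rc s = - rc r :> A.
    by rewrite -rcM -expr2 sqr_sqrtr ?rcN //; lra.
  by rewrite opprD opprK.
apply: invertibleN; apply: invertibleM; apply: sa_spectrum_real => //=.
by rewrite oppr_eq0.
Qed.

Lemma positive_antisym h : positive h -> positive (- h) -> h = 0.
Proof.
move=> ph pNh; apply: nrm_eq0; apply: contrapT => /eqP h0.
have {h0} : 0 < nrm h by rewrite lt0r h0 nrm_ge0.
move=> h0; case: (sa_spectrum_norm (positive_sa ph)); apply.
  have -> : rc (nrm h) - h = - (rc (- nrm h) - (- h)) by rewrite rcN; ncring.
  by apply: invertibleN; apply: positive_inv => //; lra.
by apply: positive_inv => //; lra.
Qed.

(** Closedness in epsilon form: it pulls back along multiplications without
    any appeal to continuity. *)
Definition nclosed P := forall x,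
  (forall e : R, 0 < e -> exists2 y, P y & nrm (y - x) < e) -> P x.

Lemma nclosed_eq0 (f : A -> A) C :
  (forall x y, nrm (f x - f y) <= C * nrm (x - y)) ->
  nclosed (fun x => f x = 0).
Proof.
move=> fC x H; apply: nrm_eq0; apply/eqP; rewrite eq_le nrm_ge0 andbT leNgt.
apply/negP => fx; pose D := `|C| + 1.
have D0 : 0 < D by rewrite /D ltr_wpDl.
have [y fy yx] := H (nrm (f x) / D) (divr_gt0 fx D0).
have := fC y x; rewrite fy sub0r nrmN.
move: yx; rewrite ltr_pdivlMr // => yx h.
have : C * nrm (y - x) <= nrm (y - x) * D.
  rewrite mulrC ler_wpM2l ?nrm_ge0 // /D.
  by have := ler_norm C; lra.
lra.
Qed.

Lemma nclosed_comm c : nclosed (fun x => c * x = x * c).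
Proof.
move=> x H; apply/eqP; rewrite -subr_eq0; apply/eqP.
apply: (@nclosed_eq0 (fun x => c * x - x * c) (nrm c + nrm c)) => [u v|e e0].
  have -> : c * u - u * c - (c * v - v * c) = c * (u - v) - (u - v) * c by ncring.
  apply: (le_trans (nrmB _ _)); rewrite (mulrDl (nrm c)).
  by apply: lerD; rewrite ?nrmM // mulrC nrmM.
by have [y yc yx] := H e e0; exists y; rewrite // yc subrr.
Qed.

Lemma nclosed_annl c : nclosed (fun x => c * x = 0).
Proof.
by apply: (@nclosed_eq0 _ (nrm c)) => u v; rewrite -mulrBr nrmM.
Qed.

Lemma nclosed_annr c : nclosed (fun x => x * c = 0).
Proof.
by apply: (@nclosed_eq0 _ (nrm c)) => u v; rewrite -mulrBl mulrC nrmM.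
Qed.

Lemma nclosed_sa : nclosed (fun x => star x = x).
Proof.
move=> x H; apply/eqP; rewrite -subr_eq0; apply/eqP.
apply: (@nclosed_eq0 (fun x => star x - x) 2) => [u v|e e0].
  have -> : star u - u - (star v - v) = star (u - v) - (u - v).
    by rewrite starB; ncring.
  by apply: (le_trans (nrmB _ _)); rewrite nrm_star; lra.
by have [y yc yx] := H e e0; exists y; rewrite // yc subrr.
Qed.

Lemma nclosed_nrm M : nclosed (fun x => nrm x <= M).
Proof.
move=> x H; rewrite leNgt; apply/negP => Mx.
have [|y yM yx] := H (nrm x - M); first by rewrite subr_gt0.
have := nrmB y (y - x); have -> : y - (y - x) = x by ncring.
lra.
Qed.

(** The iteration y |-> (t + y ^ 2) / 2 is majorized by the same iteration on
    real numbers with t = 1, which increases to 1; so it converges for every t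
    in the closed unit ball, without any spectral hypothesis.  The last clause
    is the induction principle for closed properties of the limit. *)
Lemma sqrt_one_sub t : nrm t <= 1 -> exists d, [/\ (1 - d) * (1 - d) = 1 - t,
  nrm d <= nrm t & forall P, nclosed P -> P 0 ->
    (forall y, P y -> P (rc 2^-1 * (t + y * y))) -> P d].
Proof.
move=> t1; pose u := fix u n := if n is m.+1 then rc 2^-1 * (t + u m * u m) else 0.
have uE n : u n.+1 = rc 2^-1 * (t + u n * u n) by [].
pose d := fix d n : R := if n is m.+1 then 2^-1 * (1 + d m * d m) else 0.
have dE n : d n.+1 = 2^-1 * (1 + d n * d n) by [].
have d01 n : 0 <= d n <= 1.
  elim: n => [|n /andP[d0 d1]]; first by rewrite /= lexx ler01.
  have := mulr_ge0 d0 d0; have : d n * d n <= 1 * 1 by apply: ler_pM.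
  by rewrite dE; lra.
have un n : nrm (u n) <= d n.
  elim: n => [|n IH]; first by rewrite /= nrm0.
  rewrite uE dE nrm_rcM ger0_norm; last by lra.
  rewrite ler_wpM2l //; first by lra.
  apply: (le_trans (nrmD _ _)); apply: lerD => //.
  by apply: (le_trans (nrmM _ _)); apply: ler_pM; rewrite ?nrm_ge0.
have ut n : nrm (u n) <= nrm t.
  elim: n => [|n IH]; first by rewrite /= nrm0 nrm_ge0.
  rewrite uE nrm_rcM ger0_norm; last by lra.
  have := nrmD t (u n * u n); have := nrmM (u n) (u n).
  have : nrm (u n) * nrm (u n) <= nrm t * 1.
    by apply: ler_pM; rewrite ?nrm_ge0 //; exact: le_trans IH t1.
  lra.
have [l ul] : exists l, forall e, 0 < e -> exists N, forall n, (N <= n)%N ->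
    nrm (u n - l) < e.
  apply: (@majorized_cvg _ _ u d 1) => [|n]; last by case/andP: (d01 n).
  elim=> [|n IH].
    rewrite uE dE /= !mulr0 !addr0 !subr0 mulr1 nrm_rcM ger0_norm; lra.
  have -> : u n.+2 - u n.+1 = rc 2^-1 *
      (u n.+1 * (u n.+1 - u n) + (u n.+1 - u n) * u n).
    have gen (x y : A) : rc 2^-1 * (t + x * x) - rc 2^-1 * (t + y * y) =
      rc 2^-1 * (x * (x - y) + (x - y) * y) by ncring.
    exact: gen.
  have -> : d n.+2 - d n.+1 = 2^-1 *
      (d n.+1 * (d n.+1 - d n) + (d n.+1 - d n) * d n).
    have gen (x y : R) : 2^-1 * (1 + x * x) - 2^-1 * (1 + y * y) =
      2^-1 * (x * (x - y) + (x - y) * y) by ring.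
    exact: gen.
  rewrite nrm_rcM ger0_norm; last by lra.
  rewrite ler_wpM2l //; first by lra.
  apply: (le_trans (nrmD _ _)).
  by apply: lerD; apply: (le_trans (nrmM _ _)); apply: ler_pM; rewrite ?nrm_ge0.
exists l.
have PP P : nclosed P -> (forall n, P (u n)) -> P l.
  move=> cP Pu; apply: cP => e /ul[N HN]; exists (u N) => //; exact: HN.
have lt : nrm l <= nrm t by exact: (PP _ (@nclosed_nrm _)).
split=> //; last first.
  by move=> P cP P0 PS; apply: PP => //; elim=> // n; rewrite uE; exact: PS.
have l1 : nrm l <= 1 by exact: le_trans lt t1.
suff fix_l : l - rc 2^-1 * (t + l * l) = 0.
  have tw : l + l = t + l * l.
    have e : l = rc 2^-1 * (t + l * l) by apply/eqP; rewrite -subr_eq0 fix_l.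
    rewrite {1 2}e -mulrDl -rcD.
    by have -> : (2^-1 + 2^-1 : R) = 1 by [lra]; rewrite rc1 mul1r.
  have -> : t = l + l - l * l by rewrite tw addrK.
  by ncring.
apply: nrm_eq0; apply/eqP; rewrite eq_le nrm_ge0 andbT leNgt; apply/negP.
set E := nrm _ => E0; have [|N HN] := ul (E / 4%:R); first by lra.
have h1 := HN _ (leqnn N); have h2 := HN _ (leqnSn N).
have : E <= nrm (u N.+1 - l) + nrm (u N - l).
  rewrite /E; have -> : l - rc 2^-1 * (t + l * l) =
    rc 2^-1 * (u N * (u N - l) + (u N - l) * l) - (u N.+1 - l).
    by rewrite uE; ncring.
  apply: (le_trans (nrmB _ _)); rewrite addrC lerD2l.
  rewrite nrm_rcM ger0_norm; last by lra.
  have := nrmD (u N * (u N - l)) ((u N - l) * l).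
  have := nrmM (u N) (u N - l); have := nrmM (u N - l) l.
  have : nrm (u N) * nrm (u N - l) <= 1 * nrm (u N - l).
    by apply: ler_wpM2r; rewrite ?nrm_ge0 // (le_trans (ut N)).
  have : nrm (u N - l) * nrm l <= nrm (u N - l) * 1.
    by apply: ler_wpM2l; rewrite ?nrm_ge0.
  lra.
lra.
Qed.

Lemma sqrt_one_sub_comm t d c :
  (forall P, nclosed P -> P 0 ->
    (forall y, P y -> P (rc 2^-1 * (t + y * y))) -> P d) ->
  c * t = t * c -> c * d = d * c.
Proof.
move=> Hd ct; apply: (Hd (fun x => c * x = x * c)).
- exact: nclosed_comm.
- by rewrite mulr0 mul0r.
move=> y cy; rewrite mulrA -rcC -!mulrA mulrDr mulrDl ct; congr (_ * (_ + _)).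
by rewrite -mulrA -cy !mulrA cy.
Qed.

Lemma sqrt_one_sub_sa t d :
  (forall P, nclosed P -> P 0 ->
    (forall y, P y -> P (rc 2^-1 * (t + y * y))) -> P d) ->
  star t = t -> star d = d.
Proof.
move=> Hd st; apply: (Hd (fun x => star x = x)).
- exact: nclosed_sa.
- by rewrite star0.
by move=> y sy; rewrite starM star_rc starD starM st sy rcC.
Qed.

Lemma positive_sqrt h : positive h -> exists k, [/\ positive k, k * k = h &
  forall c, c * h = h * c -> c * k = k * c].
Proof.
move=> ph; have sh := positive_sa ph; (* The summand 1 only keeps the scaling factor nonzero. *)
pose M := nrm h + 1.
have M0 : 0 < M by rewrite ltr_wpDl ?nrm_ge0.
have Mi0 : 0 <= M^-1 by rewrite invr_ge0 ltW.
pose t := 1 - rc M^-1 * h.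
have tE : t = rc M^-1 * (rc M - h).
  by rewrite mulrBr -rcM mulVf ?rc1 // gt_eqF.
have st : star t = t by rewrite starB star1 starM star_rc sh -rcC.
have t1 : nrm t <= 1.
  rewrite tE nrm_rcM ger0_norm // -ler_pdivlMl ?invr_gt0 // invrK mulr1.
  by apply: positive_norm => //; rewrite lerDl.
have [d [dd dt Hd]] := sqrt_one_sub t1.
have sd := sqrt_one_sub_sa Hd st.
pose q := Num.sqrt M.
have pd : positive (1 - d).
  rewrite -rc1; apply: positive_rc_sub => //; exact: le_trans dt t1.
exists (rc q * (1 - d)); split.
- by apply: positive_rcM => //; exact: sqrtr_ge0.
- rewrite -mulrA (mulrA _ (rc q)) -(rcC q (1 - d)) -mulrA dd mulrA -rcM.
  rewrite -expr2 sqr_sqrtr ?ltW // /t opprB addrCA subrr addr0 mulrA -rcM.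
  by rewrite mulfV ?rc1 ?mul1r // gt_eqF.
move=> c ch; have ct : c * t = t * c.
  by rewrite /t mulrBr mulrBl mulr1 mul1r mulrA -rcC -!mulrA ch.
have cd := sqrt_one_sub_comm Hd ct.
by rewrite mulrA -rcC -!mulrA mulrBr mulrBl cd mulr1 mul1r.
Qed.

(** Take z = (k + a) / 2 and y = (k - a) / 2 with k the absolute value of a.
    They are positive because (r - z) (r - y) = r (r - k) is invertible for
    negative r. *)
Lemma positive_parts a : star a = a -> exists z y,
  [/\ positive z, positive y, a = z - y, z * y = 0 & y * z = 0].
Proof.
move=> sa; have [k [pk kk kc]] := positive_sqrt (positive_sqr sa).
have ak : a * k = k * a by apply: kc; rewrite mulrA.
have sk := positive_sa pk.
pose z := rc 2^-1 * (k + a); pose y := rc 2^-1 * (k - a).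
have h2 : (2^-1 + 2^-1 : R) = 1 by lra.
have zy : z * y = 0.
  rewrite /z /y -mulrA (mulrA (k + a)) -rcC -mulrA.
  have -> : (k + a) * (k - a) = k * k - a * a + (a * k - k * a) by ncring.
  by rewrite ak kk !subrr addr0 !mulr0.
have yz : y * z = 0.
  rewrite /z /y -mulrA (mulrA (k - a)) -rcC -mulrA.
  have -> : (k - a) * (k + a) = k * k - a * a - (a * k - k * a) by ncring.
  by rewrite ak kk !subrr !mulr0.
have sz : star z = z by rewrite starM star_rc starD sa sk -rcC.
have sy : star y = y by rewrite starM star_rc starB sa sk -rcC.
have kE : k = z + y.
  rewrite /z /y -mulrDr; have -> : k + a + (k - a) = k + k by ncring.
  by rewrite mulrDr -mulrDl -rcD h2 rc1 mul1r.
have aE : a = z - y.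
  rewrite /z /y -mulrBr; have -> : k + a - (k - a) = a + a by ncring.
  by rewrite mulrDr -mulrDl -rcD h2 rc1 mul1r.
have prod r : r < 0 -> invertible ((rc r - z) * (rc r - y)).
  move=> r0; have -> : (rc r - z) * (rc r - y) = rc r * (rc r - k).
    rewrite kE; have -> : (rc r - z) * (rc r - y) =
      rc r * (rc r - (z + y)) + (rc r * z - z * rc r) + z * y by ncring.
    by rewrite zy (rcC r z) subrr !addr0.
  by apply: invertible_rcM; [rewrite lt_eqF | exact: positive_inv].
have cm r : (rc r - z) * (rc r - y) = (rc r - y) * (rc r - z).
  rewrite !mulrBl !mulrBr zy yz -!(rcC r) !subr0.
  by rewrite -!addrA; congr (_ + _); rewrite addrC.
exists z, y; split=> //; apply: positiveP => // r r0.
  by apply: invertible_commM (cm r) _; exact: prod.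
by apply: invertible_commM (esym (cm r)) _; rewrite -cm; exact: prod.
Qed.

(** If w inverts r - x y, then (1 + y w x) / r inverts r - y x: the products
    x y and y x have the same nonzero spectrum. *)
Lemma invertible_swap r x y : r != 0 -> invertible (rc r - x * y) ->
  invertible (rc r - y * x).
Proof.
move=> r0 [w [w1 w2]].
have e1 : (rc r - y * x) * (1 + y * w * x) = rc r.
  have -> : (rc r - y * x) * (1 + y * w * x) = rc r - y * x +
     y * ((rc r - x * y) * w) * x + (rc r * y - y * rc r) * (w * x) by ncring.
  by rewrite w1 mulr1 subrK (rcC r y) subrr mul0r addr0.
have e2 : (1 + y * w * x) * (rc r - y * x) = rc r.
  have -> : (1 + y * w * x) * (rc r - y * x) = rc r - y * x +
     y * (w * (rc r - x * y)) * x + y * w * (x * rc r - rc r * x) by ncring.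
  by rewrite w2 mulr1 subrK (rcC r x) subrr mulr0 addr0.
exists (rc r^-1 * (1 + y * w * x)); split.
  by rewrite rcC mulrA e1 rcV.
by rewrite -mulrA e2 -rcM mulVf // rc1.
Qed.

Lemma sa_cube0 y : star y = y -> y * y * y = 0 -> y = 0.
Proof.
move=> sy y3; apply: nrm_eq0.
have : nrm (y * y * (y * y)) = nrm y ^+ 2 ^+ 2.
  by rewrite -(nrm_sa sy) nrm_sa // starM sy.
rewrite mulrA y3 mul0r nrm0 => /esym/eqP.
by rewrite !expf_eq0 /= => /eqP.
Qed.

Lemma positive_cube y : positive y -> positive (y * y * y).
Proof.
move=> py; have sy := positive_sa py; have [k [pk kk _]] := positive_sqrt py.
have -> : y * y * y = (y * k) * (y * k).
  by rewrite -kk !mulrA.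
apply: positive_sqr; rewrite starM sy (positive_sa pk).
by rewrite -kk mulrA.
Qed.

(** The argument of Fukamiya and Kaplansky.  If y is the negative part of
    m * star m and n = y m, then n * star n = - y ^ 3 is negative, hence so is
    star n * n; but star n * n + n * star n is twice a sum of two squares of
    self-adjoint elements.  So n, and with it y, vanishes. *)
Lemma positive_mul_star m : positive (m * star m).
Proof.
set s := m * star m; have ss : star s = s by rewrite starM starK.
have [z [y [pz py sE zy yz]]] := positive_parts ss.
have sy := positive_sa py; pose n := y * m.
have nn : n * star n = - (y * y * y).
  rewrite /n starM sy mulrA -(mulrA y) -/s sE mulrBr mulrBl yz mul0r sub0r.
  by [].
have py3 := positive_cube py.
have pNn : positive (- (star n * n)).
  apply: positiveP => [|r r0]; first by rewrite starN starM starK.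
  have -> : rc r - - (star n * n) = - (rc (- r) - star n * n).
    by rewrite rcN; ncring.
  apply: invertibleN; apply: invertible_swap; first by rewrite oppr_eq0 lt_eqF.
  rewrite nn; have -> : rc (- r) - - (y * y * y) = - (rc r - y * y * y).
    by rewrite rcN; ncring.
  by apply: invertibleN; exact: positive_inv.
pose a := n + star n; pose b := imag * (n - star n).
have sa : star a = a by rewrite starD starK addrC.
have sb : star b = b.
  by rewrite starM star_imag starB starK mulrN -imagC -mulrN opprB.
have ab : a * a + b * b = rc 2 * (n * star n + star n * n).
  have -> : b * b = - ((n - star n) * (n - star n)).
    rewrite /b -mulrA (mulrA (n - _)) -imagC -mulrA mulrA imag2 mulN1r.
    by [].
  by rewrite rcD rc1 /a; ncring.
have pn : positive (star n * n).
  have -> : star n * n = rc 2^-1 * (a * a + b * b) + y * y * y.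
    rewrite ab mulrA -rcM mulVf ?pnatr_eq0 // rc1 mul1r nn; ncring.
  apply: positiveD => //; apply: positive_rcM; first by lra.
  by apply: positiveD; exact: positive_sqr.
have nn0 := positive_antisym pn pNn.
have n0 : n = 0.
  by apply: nrm_eq0; apply/eqP; rewrite -sqrf_eq0 -nrm_starl nn0 nrm0.
have y0 : y = 0.
  apply: sa_cube0 => //; apply/eqP; rewrite -oppr_eq0 -nn n0 mul0r //.
by rewrite sE y0 subr0.
Qed.

Lemma positive_star_mul m : positive (star m * m).
Proof. by rewrite -{2}(starK m); exact: positive_mul_star. Qed.

Lemma positive_conj h c : positive h -> positive (star c * h * c).
Proof.
move=> ph; have [k [pk <- _]] := positive_sqrt ph.
have -> : star c * (k * k) * c = star (k * c) * (k * c).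
  by rewrite starM (positive_sa pk) !mulrA.
exact: positive_star_mul.
Qed.

Lemma nrm_le_addr x y : positive x -> positive y -> nrm x <= nrm (x + y).
Proof.
move=> px py; set M := nrm (x + y).
have pMx : positive (rc M - x).
  have -> : rc M - x = (rc M - (x + y)) + y by ncring.
  by apply: positiveD => //; apply: positive_rc_sub => //; rewrite starD !positive_sa.
rewrite leNgt; apply/negP => lt.
have M0 : 0 <= M by exact: nrm_ge0.
case: (sa_spectrum_norm (positive_sa px)); apply.
  have -> : rc (nrm x) - x = - (rc (M - nrm x) - (rc M - x)).
    by rewrite rcB; ncring.
  by apply: invertibleN; apply: positive_inv => //; lra.
by apply: positive_inv => //; lra.
Qed.

End Positivity.

(** * Projections, partial isometries and hereditary subalgebras *)

Local Notation "q <~ s" := (mvn_to_projection_in q (hereditary_subalgebra s))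
  (at level 70).

Section Projections.
Context {R : realType} {A : cstarAlgType R}.
Implicit Types (x y z h k t a b c d m n e p q g v w s : A) (r M : R).

Lemma proj_nrm_le1 p : projection p -> nrm p <= 1.
Proof.
move=> [sp pp]; have := nrm_sa sp; rewrite pp expr2.
have := nrm_ge0 p; rewrite le_eqVlt => /orP[/eqP <- _|p0 h]; first exact: ler01.
by rewrite -(ler_pM2l p0) -h mulr1.
Qed.

Lemma proj_nrm1 p : projection p -> p != 0 -> nrm p = 1.
Proof.
move=> [sp pp] /nrm_gt0 /lt0r_neq0 p0; have := nrm_sa sp; rewrite pp expr2 => h.
by apply: (mulIf p0); rewrite mul1r -h.
Qed.

Lemma nrm_contr_l v x : nrm v <= 1 -> nrm (v * x) <= nrm x.
Proof.
by move=> v1; apply: (le_trans (nrmM _ _)); rewrite ler_piMl ?nrm_ge0.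
Qed.

Lemma nrm_contr_r v x : nrm v <= 1 -> nrm (x * v) <= nrm x.
Proof.
by move=> v1; apply: (le_trans (nrmM _ _)); rewrite ler_piMr ?nrm_ge0.
Qed.

Lemma projection1B p : projection p -> projection (1 - p).
Proof.
move=> [sp pp]; split; first by rewrite starB star1 sp.
by have -> : (1 - p) * (1 - p) = 1 - p - p + p * p by [ncring]; rewrite pp subrK.
Qed.

Lemma projectionB p q : projection p -> projection q -> p * q = q ->
  projection (p - q).
Proof.
move=> [sp pp] [sq qq] pq; split; first by rewrite starB sp sq.
have qp : q * p = q by have := congr1 star pq; rewrite starM sp sq.
have -> : (p - q) * (p - q) = p * p - p * q - q * p + q * q by ncring.
by rewrite pp pq qp qq subrK.
Qed.

Lemma pisom_mulr v p : projection p -> star v * v = p -> v * p = v.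
Proof.
move=> [sp pp] vp; apply/eqP; rewrite -subr_eq0; apply/eqP; apply: nrm_eq0.
apply/eqP; rewrite -sqrf_eq0 -nrm_starl starB starM sp.
have -> : (p * star v - star v) * (v * p - v) =
  p * (star v * v) * p - p * (star v * v) - star v * v * p + star v * v.
  by ncring.
by rewrite vp !pp subrr sub0r addNr nrm0.
Qed.

Lemma pisom_star v p : projection p -> star v * v = p -> p * star v = star v.
Proof.
by move=> pp vp; have [sp _] := pp; rewrite -[in RHS](pisom_mulr pp vp) starM sp.
Qed.

Lemma pisom_mull v p q : projection p -> star v * v = p -> v * star v = q ->
  q * v = v.
Proof. by move=> pp vp <-; rewrite -mulrA vp (pisom_mulr pp). Qed.

Lemma pisom_nrm v p : projection p -> star v * v = p -> nrm v <= 1.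
Proof.
move=> pp vp; rewrite -(ler_pXn2r (n := 2)) ?nnegrE ?nrm_ge0 // expr1n.
by rewrite -nrm_starl vp proj_nrm_le1.
Qed.

Lemma pisom_range v p : projection p -> star v * v = p -> projection (v * star v).
Proof.
move=> pp vp; split; first by rewrite starM starK.
by rewrite mulrA (pisom_mull pp vp erefl).
Qed.

Lemma inv_comm c x y : c * x = x * c -> x * y = 1 -> y * x = 1 ->
  c * y = y * c.
Proof.
move=> cx xy yx.
by rewrite -[LHS]mul1r -yx -mulrA (mulrA x) -cx -(mulrA c) xy mulr1.
Qed.

Lemma inv_sa x y : star x = x -> x * y = 1 -> star y = y.
Proof.
move=> sx xy; have e : star y * x = 1.
  by have := congr1 star xy; rewrite starM sx star1.
by rewrite -[LHS]mulr1 -xy mulrA e mul1r.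
Qed.

(** With t = g - star n * n small, star n * n = g (1 - t) is invertible in the
    corner of g, and S = (1 - t) ^ (- 1 / 2) makes n S a partial isometry. *)
Lemma polar g n : projection g -> n * g = n -> nrm (g - star n * n) < 1 ->
  exists S, star (n * S) * (n * S) = g /\ nrm (n * S - n) <= nrm (g - star n * n).
Proof.
move=> pg ng; have [sg gg] := pg; set t := g - _ => t1.
have gn : g * star n = star n by rewrite -{2}ng starM sg.
have gt : g * t = t by rewrite mulrBr gg mulrA gn.
have tg : t * g = t by rewrite mulrBl gg -mulrA ng.
have st : star t = t by rewrite starB sg starM starK.
have [d [dd dt Hd]] := sqrt_one_sub (ltW t1).
have sd := sqrt_one_sub_sa Hd st.
have gd : g * d = d * g by apply: (sqrt_one_sub_comm Hd); rewrite gt tg.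
have [S [S1 S2]] := neumann (le_lt_trans dt t1).
have sS : star S = S by apply: (inv_sa _ S1); rewrite starB star1 sd.
have gS : g * S = S * g.
  by apply: (inv_comm _ S1 S2); rewrite mulrBl mulrBr gd mul1r mulr1.
have nSg : star (n * S) * (n * S) = g.
  rewrite starM sS; have -> : S * star n * (n * S) = S * (star n * n) * S.
    by rewrite !mulrA.
  have -> : star n * n = g * (1 - t).
    by rewrite mulrBr gt mulr1 /t opprB addrCA subrr addr0.
  rewrite -dd; have -> : S * (g * ((1 - d) * (1 - d))) * S =
    S * g * (1 - d) * ((1 - d) * S) by rewrite !mulrA.
  by rewrite S1 mulr1 -gS -mulrA S2 mulr1.
exists S; split=> //.
have -> : n * S - n = n * S * d.
  have -> : n * S * d = n * S - n * (S * (1 - d)) by ncring.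
  by rewrite S2 mulr1.
by apply: (le_trans _ dt); apply: nrm_contr_l; apply: pisom_nrm nSg.
Qed.

(** Make the self-adjoint element 2 b - 1 unitary by dividing by its absolute
    value; this is possible since (2 b - 1) ^ 2 = 1 - 4 (b - b ^ 2) is close
    to 1.  The last clause keeps r in any corner that contains b. *)
Lemma near_projection b (eta : R) : star b = b -> nrm (b * b - b) <= eta ->
  eta < 4^-1 -> exists r : A, [/\ projection r, nrm (r - b) <= 2 * eta &
    forall c, b * c = 0 -> r * c = 0].
Proof.
move=> sb be e4; pose j0 := b + b - 1; pose t := rc 4 * (b - b * b).
have t4 : nrm t <= 4 * eta.
  by rewrite nrm_rcM ger0_norm // nrm_sub ler_wpM2l.
have t1 : nrm t < 1 by apply: le_lt_trans t4 _; lra.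
have st : star t = t by rewrite starM star_rc starB starM sb -rcC.
have jj : j0 * j0 = 1 - t.
  have e4E : rc 4 = 1 + 1 + 1 + 1 :> A by rewrite !rcD rc1 !addrA.
  by rewrite /t e4E /j0; ncring.
have [d [dd dt Hd]] := sqrt_one_sub (ltW t1).
have sd := sqrt_one_sub_sa Hd st.
have [S [S1 S2]] := neumann (le_lt_trans dt t1).
have sS : star S = S by apply: (inv_sa _ S1); rewrite starB star1 sd.
have sj : star j0 = j0 by rewrite starB star1 starD sb.
have bt : b * t = t * b.
  by rewrite /t mulrA -rcC -!mulrA mulrBr mulrBl mulrA.
have bd : b * d = d * b by apply: (sqrt_one_sub_comm Hd).
have jd : j0 * d = d * j0 by rewrite mulrBl mulrBr mulrDl mulrDr bd mul1r mulr1.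
have jS : j0 * S = S * j0.
  by apply: (inv_comm _ S1 S2); rewrite (mulrBr j0) (mulrBl j0) jd mul1r mulr1.
pose j := j0 * S.
have sjS : star j = j by rewrite starM sS sj -jS.
have j2 : j * j = 1.
  rewrite /j {1}jS -mulrA (mulrA j0) jj -dd -!mulrA S1 mulr1 S2.
  by [].
have nj : nrm j = 1.
  have := nrm_sa sjS; rewrite j2 nrm1 => /esym/eqP.
  rewrite sqrf_eq1 => /orP[/eqP //|/eqP h]; have := nrm_ge0 j; lra.
have h2 : rc 2^-1 * (1 + 1) = 1 :> A.
  by rewrite -rc1 -rcD -rcM; congr rc; lra.
exists (rc 2^-1 * (1 + j)); split.
- split; first by rewrite starM star_rc starD star1 sjS rcC.
  rewrite -mulrA (mulrA (1 + j)) -rcC -(mulrA (rc _)).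
  have -> : (1 + j) * (1 + j) = (1 + 1) * (1 + j) + (j * j - 1) by ncring.
  by rewrite j2 subrr addr0 (mulrA _ (1 + 1)) h2 mul1r.
- have -> : rc 2^-1 * (1 + j) - b = rc 2^-1 * (j * d).
    have -> : j * d = j - j0.
      have -> : j * d = j - j0 * (S * (1 - d)) by rewrite /j; ncring.
      by rewrite S2 mulr1.
    rewrite {1}/j0; have -> : j - (b + b - 1) = 1 + j - (1 + 1) * b by ncring.
    by rewrite [RHS]mulrBr mulrA h2 mul1r.
  rewrite nrm_rcM ger0_norm; last by lra.
  have := nrmM j d; rewrite nj mul1r => h.
  lra.
move=> c bc.
have tc : t * c = 0 by rewrite /t -mulrA mulrBl -mulrA bc mulr0 subrr mulr0.
have dc : d * c = 0.
  apply: (Hd (fun x => x * c = 0)); [exact: nclosed_annr | exact: mul0r | ].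
  by move=> y yc; rewrite -mulrA mulrDl -mulrA yc mulr0 tc addr0 mulr0.
have Sc : S * c = c.
  have {1}-> : c = (1 - d) * c by rewrite mulrBl dc subr0 mul1r.
  by rewrite mulrA S2 mul1r.
rewrite -mulrA mulrDl mul1r /j -mulrA Sc mulrBl mulrDl bc mul1r addr0 sub0r.
by rewrite subrr mulr0.
Qed.

Lemma herP s y : hereditary_subalgebra s y <->
  forall r, 0 < r -> exists a, nrm (s * a * s - y) < r.
Proof.
split=> [/(closureP _ _).1 H r r0|H].
  by have [_ [a _ <-] ya] := H r r0; exists a.
apply: (closureP _ _).2 => r r0; have [a ya] := H r r0.
by exists (s * a * s) => //; exists a.
Qed.

Lemma her_mem s a : hereditary_subalgebra s (s * a * s).
Proof. by apply: (herP _ _).2 => r r0; exists a; rewrite subrr nrm0. Qed.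
Arguments her_mem : clear implicits.

Lemma her0 s : hereditary_subalgebra s 0.
Proof. by have := her_mem s 0; rewrite mulr0 mul0r. Qed.

Lemma nclosed_her s : nclosed (hereditary_subalgebra s).
Proof.
move=> x H; apply: (herP _ _).2 => r r0; have r2 : 0 < r / 2 by lra.
have [y /herP/(_ _ r2)[a ya] yx] := H _ r2.
exists a; have -> : s * a * s - x = (s * a * s - y) + (y - x) by ncring.
apply: (le_lt_trans (nrmD _ _)); lra.
Qed.

Lemma herD s x y : hereditary_subalgebra s x -> hereditary_subalgebra s y ->
  hereditary_subalgebra s (x + y).
Proof.
move=> hx hy; apply: (herP _ _).2 => r r0; have r2 : 0 < r / 2 by lra.
have [a1 h1] := (herP _ _).1 hx _ r2.
have [a2 h2] := (herP _ _).1 hy _ r2.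
exists (a1 + a2).
have -> : s * (a1 + a2) * s - (x + y) = (s * a1 * s - x) + (s * a2 * s - y).
  by ncring.
apply: (le_lt_trans (nrmD _ _)); lra.
Qed.

Lemma nclosed_mulr P c : nclosed P -> nclosed (fun x => P (x * c)).
Proof.
move=> cP x H; apply: cP => r r0; have C0 : 0 < nrm c + 1.
  by rewrite ltr_wpDl ?nrm_ge0.
have [y Py yx] := H _ (divr_gt0 r0 C0); exists (y * c) => //.
rewrite -mulrBl; apply: (le_lt_trans (nrmM _ _)).
move: yx; rewrite ltr_pdivlMr //; have := nrm_ge0 (y - x); lra.
Qed.

Lemma nclosed_mull P c : nclosed P -> nclosed (fun x => P (c * x)).
Proof.
move=> cP x H; apply: cP => r r0; have C0 : 0 < nrm c + 1.
  by rewrite ltr_wpDl ?nrm_ge0.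
have [y Py yx] := H _ (divr_gt0 r0 C0); exists (c * y) => //.
rewrite -mulrBr; apply: (le_lt_trans (nrmM _ _)).
move: yx; rewrite ltr_pdivlMr //; have := nrm_ge0 (y - x); lra.
Qed.

Lemma her_ind P s y : nclosed P -> (forall a, P (s * a * s)) ->
  hereditary_subalgebra s y -> P y.
Proof.
move=> cP H /herP hy; apply: cP => r /hy[a ya]; by exists (s * a * s).
Qed.

Lemma her_sandwich s x y a : hereditary_subalgebra s x ->
  hereditary_subalgebra s y -> hereditary_subalgebra s (x * a * y).
Proof.
move=> hx hy; pose P := hereditary_subalgebra s.
apply: (her_ind (P := fun x => P (x * a * y)) _ _ hx) => [|b].
  have := @nclosed_mulr (fun z => P (z * y)) a.
  by apply; apply: nclosed_mulr; exact: nclosed_her.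
apply: (her_ind (P := fun y => P (s * b * s * a * y)) _ _ hy) => [|c].
  by apply: nclosed_mull; exact: nclosed_her.
have -> : s * b * s * a * (s * c * s) = s * (b * s * a * s * c) * s.
  by rewrite !mulrA.
exact: her_mem.
Qed.

Lemma her_mono s z y : hereditary_subalgebra s z -> hereditary_subalgebra z y ->
  hereditary_subalgebra s y.
Proof.
move=> hz; apply: her_ind => [|a]; first exact: nclosed_her.
exact: her_sandwich.
Qed.

Lemma her_rcM s x r : hereditary_subalgebra s x ->
  hereditary_subalgebra s (rc r * x).
Proof.
apply: (her_ind (P := fun y => hereditary_subalgebra s (rc r * y))) => [|a].
  by apply: nclosed_mull; exact: nclosed_her.
have -> : rc r * (s * a * s) = s * (rc r * a) * s by rewrite !mulrA (rcC r s).
exact: her_mem.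
Qed.

Lemma her_annl s y c : c * s = 0 -> hereditary_subalgebra s y -> c * y = 0.
Proof.
move=> cs; apply: (her_ind (P := fun y => c * y = 0)) => [|a].
  exact: nclosed_annl.
by rewrite !mulrA cs !mul0r.
Qed.

Lemma her_annr s y c : s * c = 0 -> hereditary_subalgebra s y -> y * c = 0.
Proof.
move=> cs; apply: (her_ind (P := fun y => y * c = 0)) => [|a].
  exact: nclosed_annr.
by rewrite -!mulrA cs !mulr0.
Qed.

Lemma sub_mono q s z : hereditary_subalgebra s z -> q <~ z -> q <~ s.
Proof.
by move=> hz [e [pe he qe]]; exists e; split => //; exact: her_mono hz he.
Qed.

Lemma sub_mvn w q q' s : projection q -> star w * w = q -> w * star w = q' -> q' <~ s -> q <~ s.
Proof.
move=> pq wq wq' [e [pe he [v [vq ve]]]]; exists e; split=> //.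
have pq' : projection q' by rewrite -wq'; exact: pisom_range pq wq.
exists (v * w); rewrite starM; split.
  by rewrite mulrA -(mulrA (star w)) vq -mulrA (pisom_mull pq wq wq') wq.
by rewrite mulrA -(mulrA v) wq' (pisom_mulr pq' vq).
Qed.

Lemma sub_le q q' s : projection q -> projection q' -> q' * q = q -> q' <~ s -> q <~ s.
Proof.
move=> pq pq' q'q [e [pe he [v [vq ve]]]]; have [sq qq] := pq.
have vqq : star (v * q) * (v * q) = q.
  by rewrite starM sq mulrA -(mulrA q) vq -mulrA q'q qq.
exists (v * q * star (v * q)); split.
- exact: pisom_range vqq.
- have ev : e * v = v by exact: pisom_mull pq' vq ve.
  have [se _] := pe.
  have -> : v * q * star (v * q) = e * (v * q * star (v * q)) * e.
    by rewrite -{1 2}ev !starM se !mulrA.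
  exact: her_sandwich.
by exists (v * q).
Qed.

(** The partial isometry given by polar has source g and, because q n = n,
    range below q. *)
Lemma sub_polar g n q s : projection g -> projection q -> n * g = n ->
  q * n = n -> nrm (g - star n * n) < 1 -> q <~ s -> g <~ s.
Proof.
move=> pg pq ng qn lt qs; have [S [nS _]] := polar pg ng lt.
apply: (sub_mvn pg nS erefl).
apply: sub_le (pisom_range pg nS) pq _ qs.
by rewrite !mulrA qn.
Qed.

Lemma sub_add q1 q2 s1 s2 s : q1 * q2 = 0 -> projection q1 -> projection q2 ->
  star s1 = s1 -> star s2 = s2 -> s1 * s2 = 0 ->
  hereditary_subalgebra s s1 -> hereditary_subalgebra s s2 ->
  q1 <~ s1 -> q2 <~ s2 -> q1 + q2 <~ s.
Proof.
move=> q12 pq1 pq2 ss1 ss2 s12 h1 h2 [e1 [pe1 he1 [v1 [vq1 ve1]]]].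
move=> [e2 [pe2 he2 [v2 [vq2 ve2]]]].
have [sq1 _] := pq1; have [sq2 _] := pq2.
have [se1 ee1] := pe1; have [se2 ee2] := pe2.
have e12 : e1 * e2 = 0.
  apply: (her_annl (s := s2)) => //; exact: (her_annr (s := s1)).
have e21 : e2 * e1 = 0 by rewrite -se1 -se2 -starM e12 star0.
have v12 : star v1 * v2 = 0.
  rewrite -(pisom_mull pq1 vq1 ve1) -(pisom_mull pq2 vq2 ve2) starM se1.
  by rewrite mulrA -(mulrA _ e1) e12 mulr0 mul0r.
have v21 : star v2 * v1 = 0 by rewrite -(starK v1) -starM v12 star0.
have w12 : v1 * star v2 = 0.
  rewrite -(pisom_mulr pq1 vq1) -(pisom_mulr pq2 vq2) starM sq2.
  by rewrite mulrA -(mulrA _ q1) q12 mulr0 mul0r.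
have w21 : v2 * star v1 = 0 by rewrite -(starK v2) -starM w12 star0.
exists (e1 + e2); split.
- split; first by rewrite starD se1 se2.
  by rewrite mulrDl !mulrDr ee1 ee2 e12 e21 addr0 add0r.
- by apply: herD; [exact: her_mono h1 he1 | exact: her_mono h2 he2].
exists (v1 + v2); split.
  by rewrite starD mulrDl !mulrDr v12 v21 vq1 vq2 addr0 add0r.
by rewrite starD mulrDl !mulrDr w12 w21 ve1 ve2 addr0 add0r.
Qed.

(** Spectral values of s + eta are at least eta; this gives both the inverse
    square root and the bound 1 / eta for its square. *)
Lemma positive_shift_inv s (eta : R) : positive s -> 0 < eta -> exists rho,
  [/\ star rho = rho, rho * s = s * rho, rho * rho * (s + rc eta) = 1 &
      nrm (rho * rho) <= eta^-1].
Proof.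
move=> ps eta0; pose h := s + rc eta.
have ih : invertible h.
  have -> : h = - (rc (- eta) - s) by rewrite rcN opprB opprK.
  by apply: invertibleN; apply: positive_inv => //; lra.
have ph : positive h by apply: positiveD => //; apply: positive_rc; exact: ltW.
have [k [pk kk kc]] := positive_sqrt ph.
have ik : invertible k by apply: (@invertible_commM _ _ k k) => //; rewrite kk.
have [rho [r1 r2]] := ik.
have sk := positive_sa pk.
have srho : star rho = rho by exact: inv_sa sk r1.
have sk' : s * k = k * s by apply: kc; rewrite /h mulrDr mulrDl rcC.
have rs : rho * s = s * rho.
  by rewrite -[LHS]mulr1 -r1 mulrA -(mulrA rho) sk' !mulrA r2 mul1r.
have rh : rho * rho * h = 1 by rewrite -kk mulrA -(mulrA rho) r2 mulr1.
exists rho; split=> //; rewrite leNgt; apply/negP => lt.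
set N := nrm _ in lt; have N0 : 0 < N by apply: lt_trans lt; rewrite invr_gt0.
case: (sa_spectrum_norm (positive_sa (positive_sqr srho))); rewrite -/N; apply.
  have hr : h * (rho * rho) = 1 by rewrite -kk mulrA -(mulrA k) r1 mulr1.
  have irr : invertible (rho * rho) by apply: invertible_lr rh hr.
  have -> : rc N - rho * rho = rc N * - (rho * rho * (rc (N^-1 - eta) - s)).
    have -> : rc (N^-1 - eta) - s = rc N^-1 - h by rewrite rcB /h; ncring.
    by rewrite mulrBr rh opprB mulrBr mulr1 -(rcC N^-1) (mulrA (rc N)) -rcM mulfV ?gt_eqF // rc1 mul1r.
  apply: invertible_rcM; first by rewrite gt_eqF.
  apply: invertibleN; apply: invertibleM => //; apply: positive_inv => //.
  by rewrite subr_lt0 invf_plt ?posrE.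
by apply: positive_inv; [exact: positive_sqr | lra].
Qed.

(** Let m = l x, s = m * star m and e a projection in the hereditary
    subalgebra of s.  For small eta the element
    n = star m (s + eta) ^ (- 1 / 2) e satisfies
    e - star n * n = eta e (s + eta) ^ (- 1) e, which is small because e is
    nearly of the form s a s; and the range of n lies in x A. *)
Lemma sub_swap q l x : projection q -> star x = x -> q <~ (l * x) * star (l * x) -> q <~ x.
Proof.
move=> pq sx [e [pe he [v [vq ve]]]]; apply: (sub_mvn pq vq ve).
set m := l * x in he; set s := m * star m in he.
have ps : positive s by exact: positive_mul_star.
have [|a ha] := (herP _ _).1 he 4^-1; first by lra.
(* The error is bounded by 1/4 + 2 eta norm (a s), which must stay below 1. *)
pose eta := (8 * (nrm (a * s) + 1))^-1.
have as0 := nrm_ge0 (a * s).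
have eta0 : 0 < eta by rewrite invr_gt0; lra.
have [rho [sr rs rh nr]] := positive_shift_inv ps eta0.
have [se ee] := pe.
pose n := star m * rho * e.
have ne : n * e = n by rewrite -mulrA ee.
pose Y := rc eta * (rho * rho).
have Y1 : nrm Y <= 1.
  have <- : eta * eta^-1 = 1 by rewrite mulfV // gt_eqF.
  by rewrite nrm_rcM ger0_norm ?ler_wpM2l // ltW.
have YE : rho * rho * s = 1 - Y.
  by rewrite -rh mulrDr /Y rcC addrK.
have nn : e - star n * n = e * (Y * e).
  have -> : star n * n = e * (rho * rho * s) * e.
    rewrite /n 2!starM starK sr se.
    have -> : e * (rho * m) * (star m * rho * e) = e * (rho * (s * rho)) * e.
      by rewrite /s !mulrA.
    by rewrite -rs !mulrA.
  by rewrite YE mulrBr mulrBl mulr1 ee opprB addrCA subrr addr0 mulrA.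
have lt : nrm (e - star n * n) < 1.
  rewrite nn; apply: (le_lt_trans (nrm_contr_l _ (proj_nrm_le1 pe))).
  have -> : Y * e = rc eta * ((rho * rho * s) * (a * s)) - Y * (s * a * s - e).
    rewrite /Y; ncring.
  apply: (le_lt_trans (nrmB _ _)).
  have h1 : nrm (Y * (s * a * s - e)) <= 4^-1.
    by apply: (le_trans (nrm_contr_l _ Y1)); exact: ltW.
  have h2 : nrm (rho * rho * s) <= 2.
    rewrite YE; apply: (le_trans (nrmB _ _)); rewrite nrm1; lra.
  have h3 : nrm (rc eta * (rho * rho * s * (a * s))) <= eta * (2 * nrm (a * s)).
    rewrite nrm_rcM (ger0_norm (ltW eta0)); apply: ler_wpM2l; first exact: ltW.
    by apply: (le_trans (nrmM _ _)); apply: ler_wpM2r.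
  have h4 : eta * (2 * nrm (a * s)) <= 4^-1.
    rewrite /eta mulrC ler_pdivrMr; lra.
  lra.
have [S [nS _]] := polar pe ne lt.
exists (n * S * star (n * S)); split.
- exact: pisom_range nS.
- have -> : n * S * star (n * S) =
    x * (star l * rho * e * S * star (star l * rho * e * S)) * x.
    rewrite /n /m !starM !starK sx !mulrA //.
  exact: her_mem.
by exists (n * S).
Qed.

End Projections.
Arguments her_mem {R A} s a.

(** * Automorphisms are isometric *)

Section AutomorphismNorm.
Context {R : realType} {A : cstarAlgType R}.
Variables (f : A -> A) (Hf : is_star_automorphism f).
Implicit Types (x y p q s : A).

Lemma autM x y : f (x * y) = f x * f y. Proof. by case: Hf. Qed.
Lemma autD x y : f (x + y) = f x + f y.
Proof. by case: Hf => _ fl _ _; have := fl 1 x y; rewrite !scale1r. Qed.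
Lemma aut0 : f 0 = 0.
Proof. by apply: (@addrI _ (f 0)); rewrite -autD !addr0. Qed.
Lemma autN x : f (- x) = - f x.
Proof. by apply/eqP; rewrite -addr_eq0 -autD addNr aut0. Qed.
Lemma autB x y : f (x - y) = f x - f y.
Proof. by rewrite autD autN. Qed.
Lemma autZ (c : R[i]) x : f (c *: x) = c *: f x.
Proof. by case: Hf => _ fl _ _; have := fl c x 0; rewrite aut0 !addr0. Qed.
Lemma aut_star x : f (star x) = star (f x). Proof. by case: Hf. Qed.
Lemma aut1 : f 1 = 1.
Proof.
case: Hf => [[g fK gK] _ fM _].
by have := fM 1 (g 1); rewrite mul1r gK mulr1.
Qed.
Lemma aut_rc r : f (rc r) = rc r.
Proof. by rewrite /rc autZ aut1. Qed.

Lemma aut_invertible x : invertible x -> invertible (f x).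
Proof.
by move=> [y [xy yx]]; exists (f y); rewrite -!autM xy yx aut1.
Qed.

(** The norm of a self-adjoint element is determined by invertibility, hence
    by the algebra structure alone. *)
Lemma aut_nrm_le x : nrm (f x) <= nrm x.
Proof.
rewrite -(ler_pXn2r (n := 2)) ?nnegrE ?nrm_ge0 // -!nrm_starl -aut_star -autM.
set h := star x * x; have sh : star (f h) = f h by rewrite -aut_star starM starK.
have N0 := nrm_ge0 (f h); rewrite leNgt; apply/negP => lt.
case: (sa_spectrum_norm sh); rewrite -aut_rc -autB; apply; apply: aut_invertible.
  by apply: rc_invertible; rewrite ger0_norm.
by apply: rc_invertible; rewrite normrN ger0_norm.
Qed.

Lemma aut_projection p : projection p -> projection (f p).
Proof. by move=> [sp pp]; split; rewrite -?aut_star -?autM ?sp ?pp. Qed.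

Lemma aut_sub q s : q <~ s -> f q <~ f s.
Proof.
move=> [e [pe he [v [vq ve]]]]; exists (f e); split.
- exact: aut_projection.
- apply: (herP _ _).2 => r r0; have [a ha] := (herP _ _).1 he r r0.
  exists (f a); rewrite -!autM -autB.
  exact: le_lt_trans (aut_nrm_le _) ha.
by exists (f v); rewrite -aut_star -!autM vq ve.
Qed.

End AutomorphismNorm.

(** * Simplicity: full elements and orthogonal pairs *)

Section Simple.
Context {R : realType} {A : cstarAlgType R}.
Hypothesis A_simple : simple_cstar A.
Implicit Types (x y z h k t a b c d m n e p q g v w s : A) (r M : R).

(** The closed ideal generated by z contains 1, so the algebraic ideal
    contains an element close to 1, which is invertible. *)
Lemma simple_full z : z != 0 ->
  exists l : seq (A * A), \sum_(ab <- l) ab.1 * z * ab.2 = 1.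
Proof.
move=> z0; pose I : set A :=
  [set x | exists l : seq (A * A), x = \sum_(ab <- l) ab.1 * z * ab.2].
have ID x y : I x -> I y -> I (x + y).
  by move=> [l ->] [l' ->]; exists (l ++ l'); rewrite big_cat.
have IMl a x : I x -> I (a * x).
  move=> [l ->]; exists [seq (a * ab.1, ab.2) | ab <- l].
  by rewrite big_map mulr_sumr; apply: eq_bigr => ab _ /=; rewrite !mulrA.
have IMr a x : I x -> I (x * a).
  move=> [l ->]; exists [seq (ab.1, ab.2 * a) | ab <- l].
  by rewrite big_map mulr_suml; apply: eq_bigr => ab _ /=; rewrite !mulrA.
have ncl : nclosed (closure I).
  move=> x H; apply: (closureP _ _).2 => e e0; have e2 : 0 < e / 2 by lra.
  have [y /(closureP _ _).1/(_ _ e2)[w Iw wy] yx] := H _ e2.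
  exists w => //; have -> : w - x = (w - y) + (y - x) by ncring.
  by apply: (le_lt_trans (nrmD _ _)); lra.
have ind (P : A -> Prop) y : nclosed P -> (forall a, I a -> P a) -> closure I y -> P y.
  by move=> cP H /(closureP _ _).1 hy; apply: cP => r /hy[a Ia ya]; exists a; auto.
have tsi : two_sided_ideal (closure I).
  split.
  - by apply: subset_closure; exists [::]; rewrite big_nil.
  - move=> x y /(closureP _ _).1 hx /(closureP _ _).1 hy.
    apply: (closureP _ _).2 => e e0; have e2 : 0 < e / 2 by lra.
    have [u Iu ux] := hx _ e2; have [v Iv vy] := hy _ e2.
    exists (u + v); first exact: ID.
    have -> : u + v - (x + y) = (u - x) + (v - y) by ncring.
    by apply: (le_lt_trans (nrmD _ _)); lra.
  move=> a x cx; split.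
    apply: (ind (fun x => closure I (a * x)) _ _ _ cx).
      exact: nclosed_mull.
    by move=> y Iy; apply: subset_closure; exact: IMl.
  apply: (ind (fun x => closure I (x * a)) _ _ _ cx).
    exact: nclosed_mulr.
  by move=> y Iy; apply: subset_closure; exact: IMr.
have Iz : I z by exists [:: (1, 1)]; rewrite big_seq1 mul1r mulr1.
case: (A_simple tsi (@closed_closure _ _)) => E.
  have : closure I z by exact: subset_closure.
  by rewrite E /= => /eqP; rewrite (negbTE z0).
have : closure I 1 by rewrite E.
move=> /(closureP _ _).1/(_ 1 ltr01)[x Ix /invertible_near1[y [xy _]]].
by have [l] := IMr y _ Ix; rewrite xy => ->; exists l.
Qed.

Lemma simple_prime x y : x != 0 -> y != 0 -> exists c, x * c * y != 0.
Proof.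
move=> x0 /simple_full[l l1]; apply: contrapT => H.
move/eqP: x0; apply; rewrite -[LHS]mulr1 -l1 mulr_sumr big1_seq // => ab _.
rewrite !mulrA; have -> : x * ab.1 * y = 0.
  by apply: contrapT => /eqP ne; apply: H; exists ab.1.
by rewrite mul0r.
Qed.

Lemma complex_cartesian x : exists u v, [/\ star u = u, star v = v &
  x = u + imag * v].
Proof.
exists (rc 2^-1 * (x + star x)), (rc 2^-1 * (- imag * (x - star x))); split.
- by rewrite starM star_rc starD starK -rcC (addrC (star x)).
- rewrite 2!starM star_rc starN star_imag starB starK opprK -rcC -imagC mulNr.
  by rewrite -mulrN opprB.
rewrite (mulrA imag) imagC -mulrA (mulrA imag) mulrN imag2 opprK mul1r -mulrDr.
have -> : x + star x + (x - star x) = x + x by ncring.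
have h2 : (2^-1 + 2^-1 : R) = 1 by lra.
by rewrite mulrDr -mulrDl -rcD h2 rc1 mul1r.
Qed.

Section NoOrthogonalPair.
Variable s : A.
Hypothesis orth : forall a b, star a = a -> star b = b ->
  hereditary_subalgebra s a -> hereditary_subalgebra s b -> a * b = 0 ->
  a = 0 \/ b = 0.

(** Multiply the positive and negative parts of z by z on both sides: this
    moves them into the hereditary subalgebra, where they become orthogonal
    cubes, one of which must vanish. *)
Lemma her_signed z : star z = z -> hereditary_subalgebra s z ->
  positive z \/ positive (- z).
Proof.
move=> sz hz; have [u [v [pu pv zE uv vu]]] := positive_parts sz.
have su := positive_sa pu; have sv := positive_sa pv.
have zuz : z * u * z = u * u * u.
  have -> : z * u * z = u * u * u - u * (u * v) - v * u * (u - v).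
    by rewrite zE; ncring.
  by rewrite uv vu mulr0 mul0r !subr0.
have zvz : z * v * z = v * v * v.
  have -> : z * v * z = u * v * (u - v) - v * (v * u) + v * v * v.
    by rewrite zE; ncring.
  by rewrite uv vu mulr0 mul0r subr0 add0r.
have uuvv : u * u * u * (v * v * v) = 0.
  by rewrite -!mulrA (mulrA u v) uv mul0r !mulr0.
case: (orth (a := z * u * z) (b := z * v * z)).
- by rewrite zuz 2!starM su mulrA.
- by rewrite zvz 2!starM sv mulrA.
- exact: her_sandwich.
- exact: her_sandwich.
- by rewrite zuz zvz.
- by rewrite zuz => /(sa_cube0 su) u0; right; rewrite zE u0 sub0r opprK.
by rewrite zvz => /(sa_cube0 sv) v0; left; rewrite zE v0 subr0.
Qed.

(** Since 1 is a spectral value of h, the element h ^ 2 - c h cannot be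
    negative for c < 1, so it is positive by her_signed.  Then
    0 <= h - h ^ 2 <= (1 - c) h for every c < 1. *)
Lemma her_idempotent h : positive h -> nrm h = 1 -> hereditary_subalgebra s h ->
  h * h = h.
Proof.
move=> ph h1 hh; have sh := positive_sa ph.
have ni : ~ invertible (rc 1 - h).
  case: (sa_spectrum_norm sh); rewrite h1 // => ni _; apply: ni.
  by apply: positive_inv => //; lra.
have pos (c : R) : c < 1 -> positive (h * h - rc c * h).
  move=> c1; have sz : star (h * h - rc c * h) = h * h - rc c * h.
    by rewrite starB !starM star_rc sh -rcC.
  have hz : hereditary_subalgebra s (h * h - rc c * h).
    rewrite -mulNr -rcN; apply: herD; last exact: her_rcM.
    by have -> : h * h = h * 1 * h by [rewrite mulr1]; exact: her_sandwich.
  case: (her_signed sz hz) => // pNz; exfalso; apply: ni.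
  have c0 : c - 1 < 0 by lra.
  have := positive_inv pNz c0.
  have -> : rc (c - 1) - - (h * h - rc c * h) =
      (rc 1 - h) * - (h + rc (1 - c)).
    have -> : (rc 1 - h) * - (h + rc (1 - c)) =
      h * h - rc 1 * h + h * rc (1 - c) - rc 1 * rc (1 - c) by ncring.
    by rewrite -rcC !rcB rc1; ncring.
  apply: invertible_commM.
  rewrite rc1; set t := rc (1 - c).
  have -> : (1 - h) * - (h + t) = h * h - h - t + h * t by ncring.
  by rewrite -rcC -/t; ncring.
have pd : positive (h - h * h).
  have [k [pk kk kc]] := positive_sqrt ph.
  have -> : h - h * h = star k * (rc 1 - h) * k.
    rewrite (positive_sa pk) rc1 mulrBr mulr1 mulrBl kk; congr (_ - _).
    by rewrite -kk !mulrA.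
  by apply: positive_conj; apply: positive_rc_sub => //; rewrite h1.
have bd (c : R) : c < 1 -> nrm (h - h * h) <= 1 - c.
  move=> c1; apply: (le_trans (nrm_le_addr pd (pos c c1))).
  have -> : h - h * h + (h * h - rc c * h) = rc (1 - c) * h.
    by rewrite rcB rc1; ncring.
  by rewrite nrm_rcM h1 mulr1 ger0_norm //; lra.
apply/esym/eqP; rewrite -subr_eq0; apply/eqP; apply: nrm_eq0; apply/eqP.
rewrite eq_le nrm_ge0 andbT leNgt; apply/negP => lt.
set N := nrm _ in lt bd; have := bd (1 - N / 2) _; lra.
Qed.

Hypotheses (ss : star s = s) (s0 : s != 0).

(** Normalized squares of self-adjoint elements are projections by
    her_idempotent.  If p is one and b is a self-adjoint norm-one element of
    its corner, then b ^ 2 and p - b ^ 2 are orthogonal, so b ^ 2 = p, and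
    b - p and b + p are orthogonal, so b is p or - p. *)
Lemma her_minimal_projection : exists p, [/\ projection p, p != 0 &
  forall a, exists c : R[i], p * a * p = c *: p].
Proof.
pose s' := rc (nrm s)^-1 * s; pose p := s' * s'.
have s'1 : nrm s' = 1 by exact: nrm_normalize.
have ss' : star s' = s' by rewrite starM star_rc ss -rcC.
have p1 : nrm p = 1 by rewrite nrm_sa // s'1 expr1n.
have hp : hereditary_subalgebra s p.
  have -> : p = s * (rc (nrm s)^-1 * rc (nrm s)^-1) * s.
    by rewrite /p {1}/s' rcC /s' !mulrA.
  exact: her_mem.
have pp : p * p = p by apply: her_idempotent => //; exact: positive_sqr.
have sp : star p = p by rewrite starM ss'.
have p0 : p != 0 by apply/eqP => e; move: p1; rewrite e nrm0; lra.
clearbody p; have sa_case b : star b = b -> p * b * p = b -> exists r, b = rc r * p.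
  move=> sb pb; have [->|b0] := eqVneq b 0.
    by exists 0; rewrite rc0 mul0r.
  pose b' := rc (nrm b)^-1 * b.
  have b'1 : nrm b' = 1 by exact: nrm_normalize.
  have sb' : star b' = b' by rewrite starM star_rc sb -rcC.
  have pb0 : p * b = b by have := congr1 ( *%R p) pb; rewrite !mulrA pp pb.
  have bp0 : b * p = b.
    by have := congr1 ( *%R^~ p) pb; rewrite /= -!mulrA pp !mulrA pb.
  have pb' : p * b' = b' by rewrite /b' mulrA -rcC -mulrA pb0.
  have bp' : b' * p = b' by rewrite /b' -mulrA bp0.
  have bE : b = rc (nrm b) * b'.
    by rewrite /b' mulrA -rcM mulfV ?rc1 ?mul1r // gt_eqF // nrm_gt0.
  clearbody b'; have herp x : p * x = x -> x * p = x -> hereditary_subalgebra s x.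
    by move=> px xp; have -> : x = p * x * p by [rewrite px xp]; exact: her_sandwich.
  have qq : b' * b' * (b' * b') = b' * b'.
    apply: her_idempotent; first exact: positive_sqr.
      by rewrite nrm_sa // b'1 expr1n.
    by apply: herp; rewrite ?mulrA ?pb' // -mulrA bp'.
  have qp : b' * b' = p.
    case: (orth (a := b' * b') (b := p - b' * b')).
    - by rewrite starM sb'.
    - by rewrite starB starM sb' sp.
    - by apply: herp; rewrite ?mulrA ?pb' // -mulrA bp'.
    - by apply: herp; rewrite ?mulrBl ?mulrBr pp ?mulrA ?pb' // -?mulrA ?bp'.
    - by rewrite mulrBr qq -mulrA bp' subrr.
    - move=> e; have := nrm_sa sb'; rewrite e nrm0 b'1 expr1n => h.
      by exfalso; move: h; lra.
    by move=> /eqP; rewrite subr_eq0 => /eqP.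
  case: (orth (a := b' - p) (b := b' + p)).
  - by rewrite starB sb' sp.
  - by rewrite starD sb' sp.
  - by apply: herp; rewrite ?mulrBl ?mulrBr pp ?pb' ?bp'.
  - by apply: herp; rewrite ?mulrDl ?mulrDr pp ?pb' ?bp'.
  - by rewrite mulrBl !mulrDr qp pp pb' bp' (addrC p) subrr.
  - by move=> /eqP; rewrite subr_eq0 => /eqP e; exists (nrm b); rewrite -e.
  move=> /eqP; rewrite addr_eq0 => /eqP e; exists (- nrm b).
  by rewrite {1}bE e rcN mulrN mulNr.
exists p; split=> // a.
have [u [v [su sv uv]]] := complex_cartesian a.
have [r1 e1] : exists r, p * u * p = rc r * p.
  apply: sa_case; first by rewrite !starM sp su mulrA.
  by rewrite !mulrA pp -!mulrA pp.
have [r2 e2] : exists r, p * v * p = rc r * p.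
  apply: sa_case; first by rewrite !starM sp sv mulrA.
  by rewrite !mulrA pp -!mulrA pp.
exists (r1 +i* r2).
have -> : (r1 +i* r2) *: p = (r1 +i* r2)%:A * p by rewrite -scalerAl mul1r.
rewrite complex_scalar uv mulrDr !mulrDl e1; congr (_ + _).
by rewrite (mulrA p) -imagC -!mulrA (mulrA p) e2.
Qed.

End NoOrthogonalPair.

(** Write 1 = sum a_i p b_i.  Then x = 1 x 1 is a combination of the finitely
    many elements a_i p b_j, since p (b_i x a_j) p is a multiple of p. *)
Lemma minimal_projection_finite p : projection p -> p != 0 ->
  (forall a, exists c : R[i], p * a * p = c *: p) -> finite_dimensional A.
Proof.
move=> [sp pp] p0 pA; have [l l1] := simple_full p0.
pose N := size l; pose a (i : 'I_N) := (tnth (in_tuple l) i).1.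
pose b (i : 'I_N) := (tnth (in_tuple l) i).2.
have l1' : \sum_(i < N) a i * p * b i = 1.
  by rewrite -l1 (big_tnth _ _ l).
pose T : finType := ('I_N * 'I_N)%type.
exists #|{: T}|, (fun k : 'I_#|{: T}| => a (enum_val k).1 * p * b (enum_val k).2) => x.
have cE i j : {c : R[i] | p * (b i * x * a j) * p = c *: p}.
  exact: cid.
exists (fun k : 'I_#|{: T}| => sval (cE (enum_val k).1 (enum_val k).2)).
rewrite -(big_enum_val (A := {: T}) (fun ij =>
  sval (cE ij.1 ij.2) *: (a ij.1 * p * b ij.2))) (eq_bigl predT) //=.
rewrite -(pair_bigA _ (fun i j => sval (cE i j) *: (a i * p * b j))) /=.
rewrite -[LHS]mul1r -[LHS]mulr1 -{1}l1' mulr_suml mulr_suml.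
apply: eq_bigr => i _; rewrite -l1' mulr_sumr; apply: eq_bigr => j _.
have := svalP (cE i j) => /= e.
rewrite scalerAl scalerAr -e.
by rewrite !mulrA.
Qed.

Lemma orthogonal_pair s : ~ finite_dimensional A -> star s = s -> s != 0 ->
  exists s1 s2, [/\ star s1 = s1 /\ s1 != 0, star s2 = s2 /\ s2 != 0,
    s1 * s2 = 0, hereditary_subalgebra s s1 & hereditary_subalgebra s s2].
Proof.
move=> infd ss s0; apply: contrapT => H; apply: infd.
have orth a b : star a = a -> star b = b ->
  hereditary_subalgebra s a -> hereditary_subalgebra s b -> a * b = 0 ->
  a = 0 \/ b = 0.
  move=> sa sb ha hb ab; apply: contrapT => /not_orP[/eqP a0 /eqP b0].
  by apply: H; exists a, b.
have [p [pp p0 pA]] := her_minimal_projection orth ss s0.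
exact: minimal_projection_finite pA.
Qed.

End Simple.

(** * Projections that almost commute with a finite set *)

Section Central.
Context {R : realType} {A : cstarAlgType R}.
Hypothesis A_simple : simple_cstar A.
Implicit Types (x y z a p q v w s u : A) (l : seq A) (delta eps : R).

(** Commuting p past the a_i in p = sum p a_i z b_i bounds norm p = 1 by a
    multiple of norm (p z).  The constant depends on z only. *)
Lemma central_full z : z != 0 -> exists l (C : R), 0 < C /\
  forall p delta, projection p -> p != 0 -> 0 <= delta ->
    (forall g, g \in l -> nrm (p * g - g * p) <= delta) ->
    1 <= C * (nrm (p * z) + delta).
Proof.
move=> z0; have [l l1] := simple_full A_simple z0.
pose K (ab : A * A) : R := (nrm z + nrm ab.1) * nrm ab.2.
have K0 ab : 0 <= K ab by rewrite mulr_ge0 ?addr_ge0 ?nrm_ge0.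
exists [seq ab.1 | ab <- l], (\sum_(ab <- l) K ab + 1).
split; first by apply: ltr_wpDl => //; exact: sumr_ge0.
move=> p delta pp p0 d0 comm.
rewrite -{1}(proj_nrm1 pp p0) -[X in nrm X]mulr1 -l1 mulr_sumr.
have pz0 := nrm_ge0 (p * z).
apply: (@le_trans _ _ (\sum_(ab <- l) K ab * (nrm (p * z) + delta))); last first.
  by rewrite -mulr_suml ler_wpM2r ?addr_ge0 // lerDl.
have {comm} : forall ab, ab \in l -> nrm (p * ab.1 - ab.1 * p) <= delta.
  by move=> ab abl; apply: comm; exact: map_f.
elim: l {l1} => [|ab l IH] comm; first by rewrite !big_nil nrm0.
rewrite !big_cons; apply: (le_trans (nrmD _ _)); apply: lerD; last first.
  by apply: IH => xy xyl; apply: comm; rewrite inE xyl orbT.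
have -> : p * (ab.1 * z * ab.2) =
    ((p * ab.1 - ab.1 * p) * z + ab.1 * (p * z)) * ab.2 by ncring.
apply: (le_trans (nrmM _ _)); rewrite /K [leRHS]mulrAC.
rewrite ler_wpM2r ?nrm_ge0 //; apply: (le_trans (nrmD _ _)).
have h1 := nrmM (p * ab.1 - ab.1 * p) z; have h2 := nrmM ab.1 (p * z).
have h3 : nrm (p * ab.1 - ab.1 * p) * nrm z <= delta * nrm z.
  by rewrite ler_wpM2r ?nrm_ge0 // comm // mem_head.
have h4 := mulr_ge0 (nrm_ge0 z) pz0.
have h5 := mulr_ge0 (nrm_ge0 ab.1) d0.
lra.
Qed.

(** Let z and y be the positive and negative parts of x - (1 - eps), so z is
    nonzero and z y = 0, and put z' = p z p.  If norm (p x p) <= 1 - eps, then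
    z' ^ 3 is dominated by z' ^ 3 + z' (1 - eps - p x p) z' = z' y z', which is
    nearly zero because p almost commutes with z.  So p z is small, against
    central_full. *)
Lemma central_compression x eps : positive x -> nrm x = 1 -> 0 < eps ->
  exists l delta, 0 < delta /\ forall p, projection p -> p != 0 ->
    (forall g, g \in l -> nrm (p * g - g * p) <= delta) ->
    1 - eps < nrm (p * x * p).
Proof.
move=> px x1 eps0; have sx := positive_sa px.
have sa : star (x - rc (1 - eps)) = x - rc (1 - eps) by rewrite starB star_rc sx.
have [z [y [pz py aE zy yz]]] := positive_parts sa.
have z0 : z != 0.
  apply/eqP => z0; have ni : ~ invertible (rc 1 - x).
    case: (sa_spectrum_norm sx); rewrite x1 // => ni _; apply: ni.
    by apply: positive_inv => //; lra.
  apply: ni; have : invertible (rc (- eps) - y).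
    by apply: positive_inv => //; lra.
  have -> : y = rc (1 - eps) - x by rewrite -opprB aE z0 sub0r opprK.
  have -> : rc (- eps) - (rc (1 - eps) - x) = - (rc 1 - x).
    by rewrite rcB rcN; ncring.
  by move=> /invertibleN; rewrite opprK.
have [l [C [C0 full]]] := central_full z0.
pose tau := (4 * C)^-1; pose D := nrm y * nrm z.
have tau0 : 0 < tau by rewrite invr_gt0; lra.
have D0 : 0 <= D by rewrite mulr_ge0 ?nrm_ge0.
have t3 : 0 < tau ^+ 3 / (D + 1) by rewrite divr_gt0 ?exprn_gt0 ?ltr_wpDl.
pose delta := Num.min tau (tau ^+ 3 / (D + 1)).
have delta0 : 0 < delta by rewrite lt_min tau0.
exists (z :: l), delta; split=> // p pp p0 comm.
have [sp p2] := pp; rewrite ltNge; apply/negP => le.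
have zc : nrm (z * p - p * z) <= delta.
  by rewrite nrm_sub; apply: comm; rewrite mem_head.
have ful : 1 <= C * (nrm (p * z) + delta).
  apply: full => //; first exact: ltW.
  by move=> g gl; apply: comm; rewrite inE gl orbT.
pose z' := p * z * p.
have pz' : positive z' by rewrite /z' -{1}sp; exact: positive_conj.
have sz' := positive_sa pz'.
have py' : positive (rc (1 - eps) - p * x * p).
  by apply: positive_rc_sub => //; rewrite !starM sp sx mulrA.
have z'p : z' * p = z' by rewrite /z' -mulrA p2.
have p_z' : p * z' = z' by rewrite /z' !mulrA p2.
have key : nrm (z' * z' * z') <= delta * D.
  have := nrm_le_addr (positive_cube pz') (positive_conj z' py').
  rewrite sz'; set r := rc (1 - eps).
  have xE : x = z - y + r by rewrite -aE subrK.
  have -> : z' * z' * z' + z' * (r - p * x * p) * z' = z' * y * z'.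
    have -> : z' * z' * z' + z' * (r - p * x * p) * z' =
      z' * r * z' + z' * p * y * (p * z') - z' * p * r * (p * z').
      by rewrite xE {2}/z'; ncring.
    by rewrite z'p p_z'; ncring.
  have -> : z' * y * z' = p * ((z * p - p * z) * y * z').
    have -> : p * ((z * p - p * z) * y * z') =
      z' * y * z' - p * p * (z * y) * z' by rewrite {2}/z'; ncring.
    by rewrite zy mulr0 mul0r subr0.
  move=> h; apply: (le_trans h).
  apply: (le_trans (nrm_contr_l _ (proj_nrm_le1 pp))).
  rewrite -mulrA; apply: (le_trans (nrmM _ _)).
  have p1 := proj_nrm_le1 pp.
  have h1 : nrm (y * z') <= D.
    apply: (le_trans (nrmM _ _)); rewrite ler_wpM2l ?nrm_ge0 //.
    exact: le_trans (nrm_contr_r _ p1) (nrm_contr_l _ p1).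
  by apply: ler_pM; rewrite ?nrm_ge0.
have pzz' : nrm (p * z) <= nrm z' + delta.
  have -> : p * z = z' - p * (z * p - p * z).
    have -> : z' - p * (z * p - p * z) = p * p * z by rewrite /z'; ncring.
    by rewrite p2.
  apply: (le_trans (nrmB _ _)); rewrite lerD2l.
  exact: le_trans (nrm_contr_l _ (proj_nrm_le1 pp)) zc.
have dt : delta <= tau by rewrite ge_min lexx.
have dt3 : delta * D < tau ^+ 3.
  have : delta <= tau ^+ 3 / (D + 1) by rewrite ge_min lexx orbT.
  rewrite ler_pdivlMr ?ltr_wpDl //; move: delta0; lra.
have z'tau : nrm z' < tau.
  rewrite ltNge; apply/negP => h.
  have n0 : 0 < nrm z' by exact: lt_le_trans tau0 h.
  have : tau ^+ 3 <= nrm z' ^+ 3 by rewrite lerXn2r // nnegrE ltW.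
  have : nrm z' ^+ 3 <= nrm (z' * z' * z').
    rewrite -(ler_pM2r n0) -exprSr.
    have <- : nrm (z' * z' * (z' * z')) = nrm z' ^+ 4.
      have szz : star (z' * z') = z' * z' by rewrite starM sz'.
      by rewrite (nrm_sa szz) (nrm_sa sz') -exprM.
    by rewrite mulrA nrmM.
  lra.
have Ct : C * tau = 4^-1.
  by rewrite /tau invfM mulrCA mulfV ?mulr1 // gt_eqF.
have : C * (nrm (p * z) + delta) <= C * (tau + tau + tau).
  by rewrite ler_wpM2l ?ltW //; lra.
rewrite !mulrDr Ct; lra.
Qed.

End Central.

(** * Non-vanishing in place of the norm conditions *)

Section WeakTAI.
Context {R : realType} {A : cstarAlgType R}.
Hypothesis A_simple : simple_cstar A.
Implicit Types (x y z a p q v w s u : A) (l : seq A) (delta eps : R)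
  (alpha beta : starAut A).

(** Tracial approximate innerness with the norm conditions weakened to
    p1 != 0 and with the positive norm-one element replaced by any nonzero
    self-adjoint element.  In this form the property composes. *)
Definition central_tai alpha := forall l eps s,
  0 < eps -> star s = s -> s != 0 -> exists p1 p2 v,
  [/\ [/\ projection p1, projection p2, star v * v = p1 & v * star v = alpha p2],
      forall a, a \in l -> nrm (p1 * a - a * p1) < eps /\ nrm (p2 * a - a * p2) < eps,
      forall a, a \in l -> nrm (v * a * star v - alpha (p2 * a * p2)) < eps,
      1 - p1 <~ s /\ 1 - p2 <~ s
    & p1 != 0].

Lemma tai_central alpha : tracially_approx_inner alpha -> central_tai alpha.
Proof.
move=> tai l eps s eps0 ss s0.
pose e := Num.min eps 1; have e0 : 0 < e by rewrite lt_min eps0 ltr01.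
have e1 : e <= 1 by rewrite ge_min lexx orbT.
have ee : e <= eps by rewrite ge_min lexx.
pose t := rc (nrm s)^-1 * s; pose x := t * t.
have t1 : nrm t = 1 by exact: nrm_normalize.
have st : star t = t by rewrite starM star_rc ss -rcC.
have px : positive x by exact: positive_sqr.
have nx : `|x| = 1 by rewrite nrmE nrm_sa // t1 expr1n.
have hx : hereditary_subalgebra s x.
  have -> : x = s * (rc (nrm s)^-1 * rc (nrm s)^-1) * s.
    by rewrite /x {1}/t rcC /t !mulrA.
  exact: her_mem.
have [p1 [p2 [v [[pp1 pp2 vp1 vp2] comm impl [m1 m2] [n1 n2]]]]] :=
  tai [set` l] e x (finite_seq l) e0 px nx.
exists p1, p2, v; split=> //.
- move=> a al; have [c1 c2] := comm a al.
  by move: c1 c2; rewrite !nrmE !ltcR => c1 c2; split; apply: lt_le_trans ee.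
- move=> a al; have := impl a al.
  rewrite (pisom_mulr pp1 vp1) -(mulrA (v * a)) (pisom_star pp1 vp1).
  by rewrite nrmE ltcR => c1; apply: lt_le_trans ee.
- by split; apply: sub_mono hx _.
apply/eqP => p10; move: n1; rewrite p10 !mul0r normr0.
by rewrite -[1]/(1%:C) -rmorphB /= -[0]/(0%:C) ltcR; lra.
Qed.

(** Enlarge the finite set and shrink the tolerance so that
    central_compression applies to both projections; p2 is nonzero because
    alpha maps it to an equivalent of p1. *)
Lemma central_tai_tai alpha : central_tai alpha -> tracially_approx_inner alpha.
Proof.
move=> tai F eps x /finite_seqP[l ->] eps0 px.
rewrite nrmE => /complexI x1.
have x0 : x != 0 by apply/eqP => e; move: x1; rewrite e nrm0; lra.
have [l' [delta [delta0 compr]]] := central_compression A_simple px x1 eps0.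
pose e := Num.min eps delta; have e0 : 0 < e by rewrite lt_min eps0.
have eeps : e <= eps by rewrite ge_min lexx.
have edel : e <= delta by rewrite ge_min lexx orbT.
have [p1 [p2 [v [[pp1 pp2 vp1 vp2] comm impl m12 p10]]]] :=
  tai (l ++ l') e x e0 (positive_sa px) x0.
have p20 : p2 != 0.
  apply/eqP => p20; move/eqP: p10; apply; rewrite -vp1.
  have v0 : v = 0.
    apply: nrm_eq0; apply/eqP.
    by rewrite -sqrf_eq0 -nrm_starr vp2 p20 (aut0 (starAutP alpha)) nrm0.
  by rewrite v0 mulr0.
exists p1, p2, v; split=> //.
- move=> a al; have [|c1 c2] := comm a; first by rewrite mem_cat al.
  by rewrite !nrmE !ltcR; split; apply: lt_le_trans eeps.
- move=> a al; rewrite (pisom_mulr pp1 vp1) -(mulrA (v * a)).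
  rewrite (pisom_star pp1 vp1) nrmE ltcR; apply: lt_le_trans eeps; apply: impl.
  by rewrite mem_cat al.
have C i : i \in l' -> nrm (p1 * i - i * p1) <= delta /\ nrm (p2 * i - i * p2) <= delta.
  move=> il; have [|c1 c2] := comm i; first by rewrite mem_cat il orbT.
  by split; apply: ltW; exact: lt_le_trans edel.
by rewrite !nrmE -[1]/(1%:C) -!rmorphB !ltcR; split; apply: compr => // i /C[].
Qed.

End WeakTAI.

(** * Products and inverses *)

Section Composition.
Context {R : realType} {A : cstarAlgType R}.
Implicit Types (x y z a b d g n p q r v w s u : A) (l : seq A) (delta eps : R)
  (alpha beta : starAut A).

Lemma conj_near x y a (e M : R) : nrm x <= 1 -> nrm y <= 1 -> nrm a <= M ->
  nrm (x - y) <= e -> nrm (x * a * star x - y * a * star y) <= 2 * e * M.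
Proof.
move=> x1 y1 aM xye; have e0 := le_trans (nrm_ge0 _) xye.
have -> : x * a * star x - y * a * star y =
  (x - y) * a * star x + y * (a * star (x - y)) by rewrite starB; ncring.
have -> : 2 * e * M = e * M + e * M by ring.
have sx1 : nrm (star x) <= 1 by rewrite nrm_star.
apply: (le_trans (nrmD _ _)); apply: lerD.
  apply: (le_trans (nrm_contr_r _ sx1)); apply: (le_trans (nrmM _ _)).
  by apply: ler_pM; rewrite ?nrm_ge0.
apply: (le_trans (nrm_contr_l _ y1)); apply: (le_trans (nrmM _ _)).
by rewrite nrm_star mulrC; apply: ler_pM; rewrite ?nrm_ge0.
Qed.

Lemma comm_near x y a (e M : R) : nrm a <= M -> nrm (x - y) <= e ->
  nrm (x * a - a * x) <= nrm (y * a - a * y) + 2 * e * M.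
Proof.
move=> aM xye.
have -> : x * a - a * x = (y * a - a * y) + ((x - y) * a - a * (x - y)) by ncring.
apply: (le_trans (nrmD _ _)); rewrite lerD2l.
have -> : 2 * e * M = e * M + M * e by ring.
apply: (le_trans (nrmB _ _)); apply: lerD; apply: (le_trans (nrmM _ _));
by apply: ler_pM; rewrite ?nrm_ge0.
Qed.

(** The element b = star w * p * w is almost idempotent: p almost commutes
    with w * star w, and w * star w * w = w.  A projection r near b cuts v w
    down to an element whose square is close to r, and polar decomposition
    gives a partial isometry with source r. *)
Lemma cut_partial_isometry p q v w delta :
  projection p -> projection q -> star v * v = p -> star w * w = q ->
  nrm (p * w - w * p) <= delta ->
  nrm (p * (w * star w) - w * star w * p) <= delta -> delta < 8^-1 ->
  exists r x, [/\ [/\ projection r, q * r = r & star (v * x) * (v * x) = r],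
    nrm (r - q * p) <= 3 * delta,
    nrm (r - star w * p * w) <= 2 * delta
  & nrm (v * x - v * w) <= 5 * delta].
Proof.
move=> pp pq vp wq cw cQ d8; have [sp p2] := pp; have [sq q2] := pq.
have p1 := proj_nrm_le1 pp; have v1 := pisom_nrm pp vp; have w1 := pisom_nrm pq wq.
have sw1 : nrm (star w) <= 1 by rewrite nrm_star.
have wqw : w * q = w by exact: pisom_mulr.
have Qw : w * star w * w = w by exact: pisom_mull pq wq erefl.
have d0 : 0 <= delta by exact: le_trans (nrm_ge0 _) cw.
set Q := w * star w in cQ Qw; pose b := star w * p * w.
have sb : star b = b by rewrite /b 2!starM starK sp mulrA.
have bb : nrm (b * b - b) <= delta.
  have -> : b * b - b = star w * (p * ((Q * p - p * Q) * w)).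
    have -> : star w * (p * ((Q * p - p * Q) * w)) =
      b * b - star w * (p * p) * (Q * w) by rewrite /b /Q; ncring.
    by rewrite p2 Qw.
  apply: (le_trans (nrm_contr_l _ sw1)); apply: (le_trans (nrm_contr_l _ p1)).
  by apply: (le_trans (nrm_contr_r _ w1)); rewrite nrm_sub.
have [|r [pr rb rann]] := near_projection sb bb; first by lra.
have [sr r2] := pr; have r1 := proj_nrm_le1 pr.
have rq : r * q = r.
  have := rann (1 - q); rewrite !mulrBr !mulr1 /b -(mulrA (star w * p)) wqw subrr.
  by move=> /(_ erefl)/eqP; rewrite subr_eq0 => /eqP.
have qr : q * r = r by have := congr1 star rq; rewrite starM sq sr.
have bqp : nrm (b - q * p) <= delta.
  have -> : b - q * p = star w * (p * w - w * p) by rewrite -wq /b; ncring.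
  exact: le_trans (nrm_contr_l _ sw1) cw.
pose n := v * w * r.
have nr : n * r = n by rewrite -mulrA r2.
have rn : nrm (r - star n * n) <= 2 * delta.
  have -> : r - star n * n = r * ((r - b) * r).
    have -> : star n * n = r * b * r.
      by rewrite /n 2!starM sr /b -vp !mulrA.
    have -> : r * ((r - b) * r) = r * r * r - r * b * r by ncring.
    by rewrite !r2.
  by apply: (le_trans (nrm_contr_l _ r1)); apply: (le_trans (nrm_contr_r _ r1)).
have [|S [nS Sn]] := polar pr nr; first by lra.
have xE : v * (w * r * S) = n * S by rewrite /n !mulrA.
exists r, (w * r * S); rewrite xE; split=> //.
  have -> : r - q * p = (r - b) + (b - q * p) by ncring.
  by apply: (le_trans (nrmD _ _)); lra.
have -> : n * S - v * w = (n * S - n) - v * w * (1 - r) by rewrite /n; ncring.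
apply: (le_trans (nrmB _ _)).
have : nrm (v * w * (1 - r)) <= 3 * delta.
  have -> : v * w * (1 - r) = v * (p * (p * Q - Q * p) * w - w * (r - b)).
    have -> : v * (p * (p * Q - Q * p) * w - w * (r - b)) =
      v * (p * p) * (Q * w) - v * p * Q * (p * w) - v * w * r + v * Q * p * w.
      by rewrite /b /Q; ncring.
    by rewrite p2 Qw (pisom_mulr pp vp) !mulrA addrAC subrK mulrBr mulr1.
  apply: (le_trans (nrm_contr_l _ v1)); apply: (le_trans (nrmB _ _)).
  have := le_trans (nrm_contr_r (p * (p * Q - Q * p)) w1) (nrm_contr_l _ p1).
  have := nrm_contr_l (r - b) w1; lra.
lra.
Qed.

(** Split 1 - r = (1 - q) + (q - r).  On g = q - r the element
    star w * p * w is almost zero, so w maps g almost isometrically under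
    1 - p. *)
Lemma cut_complement p q w r s1 s2 s : projection p -> projection q ->
  projection r -> star w * w = q -> q * r = r ->
  nrm (r - star w * p * w) < 1 ->
  star s1 = s1 -> star s2 = s2 -> s1 * s2 = 0 ->
  hereditary_subalgebra s s1 -> hereditary_subalgebra s s2 ->
  1 - q <~ s1 -> 1 - p <~ s2 -> 1 - r <~ s.
Proof.
move=> pp pq pr wq qr near ss1 ss2 s12 h1 h2 sub1 sub2.
have [sp p2] := pp; have [sq q2] := pq; have [sr r2] := pr.
have rq : r * q = r by have := congr1 star qr; rewrite starM sq sr.
pose g := q - r; have pg : projection g by exact: projectionB.
have [sg g2] := pg; have g1 := proj_nrm_le1 pg.
have qg : q * g = g by rewrite mulrBr q2 qr.
have gr : g * r = 0 by rewrite mulrBl qr r2 subrr.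
have -> : 1 - r = (1 - q) + g by rewrite /g addrA subrK.
apply: (sub_add _ (projection1B pq) pg ss1 ss2 s12 h1 h2) => //.
  by rewrite mulrBl mul1r qg subrr.
have p1p := projection1B pp; have [sp1 p12] := p1p.
apply: (@sub_polar _ _ g ((1 - p) * w * g) (1 - p)) => //.
- by rewrite -(mulrA _ g g) g2.
- by rewrite !mulrA p12.
rewrite 2!starM sg sp1.
have -> : g - g * (star w * (1 - p)) * ((1 - p) * w * g) =
    g * ((star w * p * w - r) * g).
  have -> : g * (star w * (1 - p)) * ((1 - p) * w * g) =
    g * (star w * ((1 - p) * (1 - p)) * w) * g by rewrite !mulrA.
  have -> : g * ((star w * p * w - r) * g) =
    g * (star w * p * w) * g - g * r * g by ncring.
  rewrite p12 gr mul0r subr0.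
  have -> : g * (star w * (1 - p) * w) * g =
    g * (star w * w) * g - g * (star w * p * w) * g by ncring.
  by rewrite wq -mulrA qg g2 opprB addrCA subrr addr0.
apply: (le_lt_trans (nrm_contr_l _ g1)); apply: (le_lt_trans (nrm_contr_r _ g1)).
by rewrite nrm_sub.
Qed.

(** Split 1 - f = (p - f) + (1 - p).  On g = p - f the compression of q is
    almost zero, so g is almost below 1 - q. *)
Lemma range_complement p q f s1 s2 s : projection p -> projection q ->
  projection f -> p * f = f -> nrm (f - p * q * p) < 1 ->
  star s1 = s1 -> star s2 = s2 -> s1 * s2 = 0 ->
  hereditary_subalgebra s s1 -> hereditary_subalgebra s s2 ->
  1 - q <~ s1 -> 1 - p <~ s2 -> 1 - f <~ s.
Proof.
move=> pp pq pf pf_f near ss1 ss2 s12 h1 h2 sub1 sub2.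
have [sp p2] := pp; have [sf f2] := pf.
have fp : f * p = f by have := congr1 star pf_f; rewrite starM sp sf.
pose g := p - f; have pg : projection g by exact: projectionB.
have [sg g2] := pg; have g1 := proj_nrm_le1 pg.
have pg_g : p * g = g by rewrite mulrBr p2 pf_f.
have gp : g * p = g by rewrite mulrBl p2 fp.
have gf : g * f = 0 by rewrite mulrBl pf_f f2 subrr.
have -> : 1 - f = g + (1 - p) by rewrite /g; ncring.
apply: (sub_add _ pg (projection1B pp) ss1 ss2 s12 h1 h2) => //.
  by rewrite mulrBr mulr1 gp subrr.
have q1p := projection1B pq; have [sq1 q12] := q1p.
apply: (@sub_polar _ _ g ((1 - q) * g) (1 - q)) => //.
- by rewrite -(mulrA _ g g) g2.
- by rewrite !mulrA q12.
rewrite starM sg sq1.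
have -> : g - g * (1 - q) * ((1 - q) * g) = g * ((p * q * p - f) * g).
  have -> : g * (1 - q) * ((1 - q) * g) = g * ((1 - q) * (1 - q)) * g.
    by rewrite !mulrA.
  have -> : g * ((p * q * p - f) * g) = g * p * q * (p * g) - g * f * g by ncring.
  rewrite q12 gf mul0r subr0 gp pg_g.
  have -> : g * (1 - q) * g = g * g - g * q * g by ncring.
  by rewrite g2 opprB addrCA subrr addr0.
apply: (le_lt_trans (nrm_contr_l _ g1)); apply: (le_lt_trans (nrm_contr_r _ g1)).
by rewrite nrm_sub.
Qed.

Hypothesis A_infd : ~ finite_dimensional A.
Hypothesis A_simple : simple_cstar A.

Lemma seq_bound l : exists M : R, 1 <= M /\ forall a, a \in l -> nrm a <= M.
Proof.
elim: l => [|x l [M [M1 HM]]]; first by exists 1.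
exists (Num.max M (nrm x)); split; first by rewrite le_max M1.
by move=> a; rewrite inE le_max => /orP[/eqP ->|/HM ->//]; rewrite lexx orbT.
Qed.

Lemma small_delta (M C eps : R) : 1 <= M -> 0 < C -> 0 < eps -> exists delta,
  [/\ 0 < delta, 100 * delta <= 1, 100 * (delta * M) <= eps & 8 * (C * delta) <= 1].
Proof.
move=> M1 C0 e0; pose a : R := 100; pose b := 100 * M / eps; pose c := 8 * C.
have a0 : 0 < a by rewrite /a.
have b0 : 0 < b by rewrite divr_gt0 //; lra.
have c0 : 0 < c by rewrite /c; lra.
have s0 : 0 < a + b + c by lra.
have bE : b * eps = 100 * M by rewrite /b divfK // gt_eqF.
exists (a + b + c)^-1; set d := _^-1.
have d0 : 0 < d by rewrite invr_gt0.
have dE : (a + b + c) * d = 1 by rewrite mulfV // gt_eqF.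
have ad : 0 < a * d by rewrite mulr_gt0.
have bd : 0 < b * d by rewrite mulr_gt0.
have cd : 0 < c * d by rewrite mulr_gt0.
move: dE; rewrite 2!mulrDl => dE; split=> //; rewrite -?/a.
- lra.
- have -> : 100 * (d * M) = b * d * eps by rewrite mulrAC bE; ring.
  by rewrite ler_piMl ?(ltW e0) //; lra.
- rewrite mulrA -/c; lra.
Qed.

(** The tolerance for alpha is chosen after the witness for beta, because it
    must beat the constant of central_full for q1, which forces r to be
    nonzero. *)
Lemma central_tai_mul alpha beta : central_tai alpha -> central_tai beta ->
  central_tai (alpha * beta)%g.
Proof.
move=> Ha Hb l eps s eps0 ss s0.
have aP := starAutP alpha; have bP := starAutP beta.
have bVP : is_star_automorphism (beta^-1)%g := starAutP _.
have aVP : is_star_automorphism (alpha^-1)%g := starAutP _.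
have aVK y : alpha ((alpha^-1)%g y) = y by exact: starAut_invKV.
have bVK y : beta ((beta^-1)%g y) = y by exact: starAut_invKV.
have bK y : (beta^-1)%g (beta y) = y by exact: starAut_invK.
have anrm y : nrm (alpha y) = nrm y.
  apply/eqP; rewrite eq_le aut_nrm_le //=.
  by have := aut_nrm_le aVP (alpha y); rewrite [X in nrm X]starAut_invK.
have bnrm y : nrm (beta y) = nrm y.
  by apply/eqP; rewrite eq_le aut_nrm_le //= -{1}(bK y) aut_nrm_le.
have [M [M1 lM]] := seq_bound l.
have [s1 [s2 [[ss1 s10] [ss2 s20] s12 h1 h2]]] :=
  orthogonal_pair A_simple A_infd ss s0.
have eps2 : 0 < eps / 2 by lra.
have [q1 [q2 [w [[pq1 pq2 wq1 wq2] bcomm bimpl [bm1 bm2] q10]]]] :=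
  Hb l _ s1 eps2 ss1 s10.
have [sq1 q12] := pq1; have [sq2 q22] := pq2.
have [l0 [C [C0 full]]] := central_full A_simple q10.
have bs20 : beta s2 != 0.
  by apply/eqP => e; move/eqP: s20; apply; apply: nrm_eq0; rewrite -bnrm e nrm0.
have sbs2 : star (beta s2) = beta s2 by rewrite -(aut_star bP) ss2.
have [c m0] := simple_prime A_simple s20 bs20.
(* The hereditary subalgebra of t lies below s2, and star m * m below beta s2. *)
pose m := s2 * c * beta s2; pose t := m * star m.
have st : star t = t by rewrite starM starK.
have t0 : t != 0.
  apply/eqP => t0; move/eqP: m0; apply; apply: nrm_eq0; apply/eqP.
  by rewrite -sqrf_eq0 -nrm_starr -/m -/t t0 nrm0.
have hts2 : hereditary_subalgebra s2 t.
  have -> : t = s2 * (c * beta s2 * beta s2 * star c) * s2.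
    by rewrite /t /m 2!starM sbs2 ss2 !mulrA.
  exact: her_mem.
have [delta [d0 d100 dM dC]] := small_delta M1 C0 eps0.
pose Q := beta q2.
pose l' := [:: w; Q] ++ l ++ [seq beta a | a <- l] ++
  [seq beta (q2 * a * q2) | a <- l] ++ l0.
have [p1 [p2 [v [[pp1 pp2 vp1 vp2] acomm aimpl [am1 am2] p10]]]] :=
  Ha l' _ t d0 st t0.
have [sp1 p12] := pp1; have [sp2 p22] := pp2.
have c1 g : g \in l' -> nrm (p1 * g - g * p1) <= delta.
  by case/acomm => /ltW.
have c2 g : g \in l' -> nrm (p2 * g - g * p2) <= delta.
  by case/acomm => _ /ltW.
have wl : w \in l' by rewrite mem_head.
have Ql : Q \in l' by rewrite inE mem_head orbT.
have ll a : a \in l -> a \in l' by move=> al; rewrite !(inE, mem_cat) al ?orbT.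
have bll a : a \in l -> beta a \in l'.
  by move=> al; rewrite !(inE, mem_cat) (map_f beta al) ?orbT.
have qll a : a \in l -> beta (q2 * a * q2) \in l'.
  move=> al; rewrite !(inE, mem_cat).
  by rewrite (map_f (fun a => beta (q2 * a * q2)) al) ?orbT.
have l0l a : a \in l0 -> a \in l' by move=> al; rewrite !(inE, mem_cat) al ?orbT.
have p11 := proj_nrm_le1 pp1; have p21 := proj_nrm_le1 pp2.
have q11 := proj_nrm_le1 pq1; have q21 := proj_nrm_le1 pq2.
have v1 := pisom_nrm pp1 vp1; have w1 := pisom_nrm pq1 wq1.
have pQ : projection Q by exact: aut_projection.
have [sQ QQ] := pQ; have Q1 := proj_nrm_le1 pQ.
have d8 : delta < 8^-1 by lra.
have [r [x [[pr qr ur] rqp rb uvw]]] := cut_partial_isometry pp1 pq1 vp1 wq1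
  (c1 _ wl) ltac:(rewrite wq2; exact: c1) d8.
set u := v * x in ur uvw; have u1 := pisom_nrm pr ur.
have vw1 : nrm (v * w) <= 1 by exact: le_trans (nrm_contr_l _ v1) w1.
have av : alpha p2 * v = v by exact: pisom_mull pp1 vp1 vp2.
pose E := u * star u; have pE : projection E by exact: pisom_range ur.
pose f2 := (alpha^-1)%g E; pose f := (beta^-1)%g f2.
have af2 : alpha f2 = E by exact: aVK.
have bf : beta f = f2 by exact: bVK.
have pf2 : projection f2 by exact: aut_projection.
have pf : projection f by exact: aut_projection.
have p2f2 : p2 * f2 = f2.
  rewrite -[LHS](starAut_invK alpha) -[RHS](starAut_invK alpha).
  by rewrite (autM aP) af2 /E /u !mulrA av.
have f2near : nrm (f2 - p2 * Q * p2) <= 11 * delta.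
  rewrite -anrm (autB aP) af2.
  have -> : E - alpha (p2 * Q * p2) = (u * 1 * star u - v * w * 1 * star (v * w))
     + (v * Q * star v - alpha (p2 * Q * p2)).
    by rewrite !mulr1 starM /E /Q -wq2; ncring.
  have h := conj_near u1 vw1 (lexx (nrm 1)) uvw; rewrite nrm1 in h.
  apply: (le_trans (nrmD _ _)); have := ltW (aimpl _ Ql); lra.
have Mpos : 0 < delta * M by rewrite mulr_gt0 //; lra.
have dleM : delta <= delta * M by rewrite ler_pMr.
exists r, f, u; split.
- by split=> //; rewrite -/E -af2 -bf.
- move=> a al; have [ca1 ca2] := bcomm _ al; have aM := lM _ al.
  have qa1 := c1 _ (ll _ al).
  split.
    apply: (le_lt_trans (comm_near aM rqp)).
    have : nrm (q1 * p1 * a - a * (q1 * p1)) <= delta + nrm (q1 * a - a * q1).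
      have -> : q1 * p1 * a - a * (q1 * p1) =
        q1 * (p1 * a - a * p1) + (q1 * a - a * q1) * p1 by ncring.
      apply: (le_trans (nrmD _ _)); apply: lerD; last exact: nrm_contr_r.
      exact: le_trans (nrm_contr_l _ q11) qa1.
    lra.
  rewrite -bnrm (autB bP) !(autM bP) bf.
  have baM : nrm (beta a) <= M by rewrite bnrm.
  have pa := c2 _ (bll _ al).
  apply: (le_lt_trans (comm_near baM f2near)).
  have : nrm (p2 * Q * p2 * beta a - beta a * (p2 * Q * p2)) <=
      delta + nrm (q2 * a - a * q2) + delta.
    have -> : p2 * Q * p2 * beta a - beta a * (p2 * Q * p2) =
      p2 * (Q * (p2 * beta a - beta a * p2)) +
      p2 * ((Q * beta a - beta a * Q) * p2) + (p2 * beta a - beta a * p2) * (Q * p2).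
      by ncring.
    have -> : Q * beta a - beta a * Q = beta (q2 * a - a * q2).
      by rewrite (autB bP) !(autM bP).
    apply: (le_trans (nrmD _ _)); apply: lerD.
      apply: (le_trans (nrmD _ _)); apply: lerD.
        apply: (le_trans (nrm_contr_l _ p21)).
        exact: (le_trans (nrm_contr_l _ Q1)).
      apply: (le_trans (nrm_contr_l _ p21)); apply: (le_trans (nrm_contr_r _ p21)).
      by rewrite bnrm.
    apply: le_trans (nrm_contr_r _ _) pa.
    exact: le_trans (nrm_contr_l _ Q1) p21.
  lra.
- move=> a al; have aM := lM _ al; have ba := bimpl _ al.
  have aB := aimpl _ (qll _ al).
  have baM : nrm (beta a) <= M by rewrite bnrm.
  have f21 := proj_nrm_le1 pf2.
  have cQ := c2 _ Ql.
  have X1 : nrm (f2 - p2 * Q) <= 12 * delta.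
    have -> : f2 - p2 * Q = (f2 - p2 * Q * p2) + p2 * (Q * p2 - p2 * Q).
      have -> : p2 * (Q * p2 - p2 * Q) = p2 * Q * p2 - p2 * p2 * Q by ncring.
      by rewrite p22; ncring.
    apply: (le_trans (nrmD _ _)).
    have := nrm_contr_l (Q * p2 - p2 * Q) p21; rewrite (nrm_sub (Q * p2)); lra.
  have X2 : nrm (f2 - Q * p2) <= 12 * delta.
    have -> : f2 - Q * p2 = (f2 - p2 * Q * p2) + (p2 * Q - Q * p2) * p2.
      have -> : (p2 * Q - Q * p2) * p2 = p2 * Q * p2 - Q * (p2 * p2) by ncring.
      by rewrite p22; ncring.
    apply: (le_trans (nrmD _ _)).
    have := nrm_contr_r (p2 * Q - Q * p2) p21; lra.
  have last_step : nrm (p2 * beta (q2 * a * q2) * p2 - f2 * beta a * f2)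
      <= 24 * (delta * M).
    rewrite !(autM bP) -/Q.
    have -> : p2 * (Q * beta a * Q) * p2 - f2 * beta a * f2 =
      - ((p2 * Q) * (beta a * (f2 - Q * p2))) - (f2 - p2 * Q) * beta a * f2.
      by ncring.
    have -> : 24 * (delta * M) = 12 * delta * M + 12 * delta * M by ring.
    apply: (le_trans (nrmB _ _)); rewrite nrmN; apply: lerD.
      have pQ1 : nrm (p2 * Q) <= 1 by exact: le_trans (nrm_contr_l _ p21) Q1.
      apply: (le_trans (nrm_contr_l _ pQ1)); apply: (le_trans (nrmM _ _)).
      by rewrite mulrC; apply: ler_pM; rewrite ?nrm_ge0.
    apply: (le_trans (nrm_contr_r _ f21)); apply: (le_trans (nrmM _ _)).
    by apply: ler_pM; rewrite ?nrm_ge0.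
  have -> : (alpha * beta)%g (f * a * f) = alpha (f2 * beta a * f2).
    by rewrite -bf -!(autM bP).
  have -> : u * a * star u - alpha (f2 * beta a * f2) =
    (u * a * star u - v * w * a * star (v * w))
    + v * ((w * a * star w - beta (q2 * a * q2)) * star v)
    + (v * beta (q2 * a * q2) * star v - alpha (p2 * beta (q2 * a * q2) * p2))
    + alpha (p2 * beta (q2 * a * q2) * p2 - f2 * beta a * f2).
    by rewrite (autB aP) starM; ncring.
  apply: (le_lt_trans (nrmD _ _)); rewrite anrm.
  have h1' := nrmD (u * a * star u - v * w * a * star (v * w)
    + v * ((w * a * star w - beta (q2 * a * q2)) * star v))
    (v * beta (q2 * a * q2) * star v - alpha (p2 * beta (q2 * a * q2) * p2)).
  have h2' := nrmD (u * a * star u - v * w * a * star (v * w))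
    (v * ((w * a * star w - beta (q2 * a * q2)) * star v)).
  have h3' := conj_near u1 vw1 aM uvw.
  have h4' : nrm (v * ((w * a * star w - beta (q2 * a * q2)) * star v)) <= eps / 2.
    apply: (le_trans (nrm_contr_l _ v1)).
    have sv1 : nrm (star v) <= 1 by rewrite nrm_star.
    apply: (le_trans (nrm_contr_r _ sv1)); exact: ltW.
  lra.
- split.
    apply: (cut_complement (p := p1) (q := q1) (w := w) (s1 := s1) (s2 := s2)) => //.
      by apply: le_lt_trans rb _; lra.
    exact: sub_mono am1.
  apply: (range_complement (p := (beta^-1)%g p2) (q := q2) (s1 := s1) (s2 := s2)) => //.
  - exact: aut_projection.
  - by rewrite -(autM bVP) p2f2.
  - rewrite -bnrm (autB bP) !(autM bP) bf bVK.
    by apply: le_lt_trans f2near _; lra.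
  have -> : 1 - (beta^-1)%g p2 = (beta^-1)%g (1 - p2).
    by rewrite (autB bVP) (aut1 bVP).
  rewrite -(bK s2); apply: (aut_sub bVP).
  by apply: sub_swap am2 => //; exact: projection1B.
apply/eqP => r0; move: rqp; rewrite r0 sub0r nrmN => qp.
have := full p1 delta pp1 p10 (ltW d0) (fun g gl => c1 _ (l0l _ gl)).
have -> : nrm (p1 * q1) = nrm (q1 * p1) by rewrite -nrm_star starM sp1 sq1.
have : C * (nrm (q1 * p1) + delta) <= C * (4 * delta).
  by apply: ler_wpM2l (ltW C0) _ _ _; lra.
lra.
Qed.

Lemma central_tai_inv alpha : central_tai alpha -> central_tai (alpha^-1)%g.
Proof.
move=> Ha l eps s eps0 ss s0.
have aP := starAutP alpha.
have aVP : is_star_automorphism (alpha^-1)%g := starAutP _.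
have aK y : (alpha^-1)%g (alpha y) = y by exact: starAut_invK.
have [p1 [p2 [v [[pp1 pp2 vp1 vp2] comm impl [m1 m2] p10]]]] := Ha l eps s eps0 ss s0.
have v1 := pisom_nrm pp1 vp1; have sv1 : nrm (star v) <= 1 by rewrite nrm_star.
exists p2, p1, ((alpha^-1)%g (star v)); rewrite -!(aut_star aVP) starK.
split=> //.
- by split=> //; rewrite -(autM aVP) ?vp1 // vp2 aK.
- by move=> a /comm[].
- move=> a al; have h := impl a al.
  rewrite -{1}(aK a) -!(autM aVP) -(autB aVP).
  apply: le_lt_trans (aut_nrm_le aVP _) _.
  have -> : star v * alpha a * v - p1 * a * p1 =
    - (star v * ((v * a * star v - alpha (p2 * a * p2)) * v)).
    have -> : star v * ((v * a * star v - alpha (p2 * a * p2)) * v) =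
      star v * v * a * (star v * v) - star v * alpha (p2 * a * p2) * v by ncring.
    rewrite vp1 !(autM aP) -vp2 opprB; congr (_ - _).
    have -> : star v * (v * star v * alpha a * (v * star v)) * v =
      (star v * v * star v) * alpha a * (v * (star v * v)) by rewrite !mulrA.
    by rewrite vp1 (pisom_star pp1 vp1) (pisom_mulr pp1 vp1).
  rewrite nrmN; apply: le_lt_trans (nrm_contr_l _ sv1) _.
  exact: le_lt_trans (nrm_contr_r _ v1) h.
apply/eqP => p20; move/eqP: p10; apply; rewrite -vp1.
have -> : v = 0.
  apply: nrm_eq0; apply/eqP.
  by rewrite -sqrf_eq0 -nrm_starr vp2 p20 (aut0 aP) nrm0.
by rewrite mulr0.
Qed.

Lemma central_tai_one : central_tai (1%g : starAut A).
Proof.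
move=> l eps s eps0 ss s0.
have p1 : projection (1 : A) by split; rewrite ?star1 ?mulr1.
have sub0 : 1 - 1 <~ s.
  exists 0; rewrite subrr; split.
  - by split; rewrite ?star0 ?mulr0.
  - exact: her0.
  by exists 0; rewrite star0 mulr0.
exists 1, 1, 1; split=> //; last exact: oner_neq0.
- by split; rewrite ?star1 ?mulr1.
- by move=> a _; rewrite mul1r mulr1 subrr nrm0.
by move=> a _; rewrite star1 !mul1r !mulr1 subrr nrm0.
Qed.

End Composition.

Theorem theorem5p8 (R : realType) (A : cstarAlgType R)
  (A_infinite_dim : ~ finite_dimensional A)
  (A_simple : simple_cstar A)
  (A_separable : separable A) :
  group_closed (mem [set alpha : starAut A | tracially_approx_inner alpha]).
Proof.
split=> [|alpha beta]; rewrite !inE /=.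
  by apply: central_tai_tai => //; exact: central_tai_one.
move=> /tai_central Ha /tai_central Hb; apply: central_tai_tai => //.
by apply: central_tai_mul => //; exact: central_tai_inv.
Qed.
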